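(* Let $W$ be the affine Weyl group of an irreducible reduced crystallographic root system $\Phi$ of rank 2. Let $w\in W$ and $i$ with $\ell(ws_i)<\ell(w)$. Let $\alpha\in\Phi$, $c\in\mathbb{Z}$, $n\ge 1$, and for $t=0,1,\dots,n$ let $r_t$ be the reflection in $H_{\alpha,c+t}$ (so $r_1,\dots,r_n$ is a sequence of adjacent parallel reflections). Suppose that the alcove $w$ lies in the strip between $H_{\alpha,c}$ and $H_{\alpha,c+1}$ (i.e. there is no hyperplane parallel to $H_{r_1}$ strictly between $w$ and $H_{r_1}$), and that for every $1\le t\le n$, $$\ell(r_t\cdots r_1ws_i)=\ell(r_{t-1}\cdots r_1ws_i)+1\quad\text{and}\quad r_t\cdots r_1ws_i\neq r_{t-1}\cdots r_1w.$$ Then $r_n\cdots r_1ws_i\in\mathrm{Annex}(w)$, i.e. $w\not\le r_n\cdots r_1 ws_i$ in Bruhat order.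
   Context: Let $E$ be a Euclidean plane with inner product $\langle\cdot,\cdot\rangle$, $\Phi\subset E$ an irreducible reduced crystallographic root system of rank 2 (type $A_2$, $B_2$ or $G_2$). For $\beta\in\Phi$ put $\beta^\vee=2\beta/\langle\beta,\beta\rangle$; for $k\in\mathbb{Z}$ put $H_{\beta,k}=\{v:\langle v,\beta\rangle=k\}$ and $s_{\beta;k}(v)=v-(\langle v,\beta\rangle-k)\beta^\vee$. The affine Weyl group $W$ generated by these is a Coxeter group with simple generators $s_0,s_1,s_2$, the reflections in the walls of the fundamental alcove $A_0$ ($s_0$ the one whose wall does not contain $0$); alcoves (components of the complement of all $H_{\beta,k}$) are identified with elements of $W$ via $w\mapsto wA_0$. For a reflection $r$, $H_r$ is its fixed hyperplane. $\ell$ is Coxeter length, $\le$ is Bruhat order, and $\mathrm{Annex}(w)=\{y\in W: w\not\le y\}$. (Empty products of reflections equal the identity.) *)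

(* Defs.v *)
From HB Require Import structures.
From mathcomp Require Import all_boot all_order all_algebra.
From mathcomp Require Import reals.
From Stdlib Require Import ClassicalEpsilon Relations.
Set Implicit Arguments. Unset Strict Implicit. Unset Printing Implicit Defensive.
Import Order.TTheory GRing.Theory Num.Theory.
Local Open Scope ring_scope.

Section AffineWeyl.
Variable R : realType.

Notation E := 'rV[R]_2.

Definition dot (u v : E) : R := (u *m v^T) 0 0.

Definition coroot (b : E) : E := (2 / dot b b) *: b.

Definition refl (b : E) (k : int) (v : E) : E :=
  v - (dot v b - k%:~R) *: coroot b.

Definition root_system (Phi : seq E) : Prop :=
  [/\ (0 : E) \notin Phi,
      (exists b1 b2, [/\ b1 \in Phi, b2 \in Phi &
                        b1 0 0 * b2 0 1 - b1 0 1 * b2 0 0 != 0]),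
      (forall b g, b \in Phi -> g \in Phi -> refl b 0 g \in Phi),
      (forall b g, b \in Phi -> g \in Phi ->
         (2 * dot g b / dot b b) \is a Num.int) &
      (forall b (x : R), b \in Phi -> x *: b \in Phi -> x = 1 \/ x = -1)].

Definition irreducible_rs (Phi : seq E) : Prop :=
  forall P : E -> Prop,
    (forall b g, b \in Phi -> g \in Phi -> P b -> ~ P g -> dot b g = 0) ->
    (forall b, b \in Phi -> P b) \/ (forall b, b \in Phi -> ~ P b).

Variable Phi : seq E.

(* rho is a regular vector; it determines the positive system
   Phi^+ = {beta | <beta,rho> > 0}. *)
Definition regular (rho : E) : Prop := forall b, b \in Phi -> dot b rho != 0.

Variable rho : E.

Definition A0 (v : E) : Prop :=
  forall b, b \in Phi -> 0 < dot b rho -> 0 < dot v b < 1.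

Definition A0_closure (v : E) : Prop :=
  forall b, b \in Phi -> 0 < dot b rho -> 0 <= dot v b <= 1.

(* H_{beta,k} is a wall of A_0: some point of the closure of A_0 lies on
   H_{beta,k} and on no other reflecting hyperplane. *)
Definition wall_of_A0 (b : E) (k : int) : Prop :=
  exists p, [/\ A0_closure p, dot p b = k%:~R &
    forall g (m : int), g \in Phi -> dot p g = m%:~R -> refl g m = refl b k].

Definition simple_refl (s : E -> E) : Prop :=
  exists b (k : int), [/\ b \in Phi, s = refl b k & wall_of_A0 b k].

Definition is_refl (t : E -> E) : Prop :=
  exists b (k : int), b \in Phi /\ t = refl b k.

Definition inW (w : E -> E) : Prop :=
  exists ts : seq (E -> E), List.Forall is_refl ts /\ w = foldr comp id ts.

Definition word_len (w : E -> E) (n : nat) : Prop :=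
  exists ss : seq (E -> E),
    [/\ size ss = n, List.Forall simple_refl ss & w = foldr comp id ss].

(* Coxeter length: the least such n (junk value outside W). *)
Definition ell (w : E -> E) : nat :=
  epsilon (inhabits 0%N)
    (fun n => word_len w n /\ forall m, word_len w m -> (n <= m)%N).

Definition bruhat_step (x y : E -> E) : Prop :=
  exists t, [/\ is_refl t, y = x \o t & (ell x < ell y)%N].

Definition bruhat_le (u w : E -> E) : Prop := clos_refl_trans _ bruhat_step u w.

End AffineWeyl.

Fixpoint rprod (R : realType) (alpha : 'rV[R]_2) (c : int) (t : nat)
  : 'rV[R]_2 -> 'rV[R]_2 :=
  match t with
  | 0%N => id
  | t'.+1 => refl alpha (c + t'.+1%:Z) \o rprod alpha c t'
  end.

(* Main.v *)
Require Import Defs.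
From mathcomp Require Import all_boot all_order all_algebra.
From mathcomp Require Import reals.
From mathcomp Require Import boolp zify ring lra.
From Stdlib Require Import Relations ClassicalEpsilon.
Set Implicit Arguments. Unset Strict Implicit. Unset Printing Implicit Defensive.
Import Order.TTheory GRing.Theory Num.Theory.
Local Open Scope ring_scope.

(** Write x_t = r_t...r_1 w s and y_t = r_t...r_1 w = x_t s.  Length counts the
    hyperplanes separating an alcove from A_0, and the lifting property gives
    x_t < y_t for all t, so A_0 lies on the side of x_t of the wall between x_t
    and y_t; let beta be a root of this wall at t = 0.  Suppose w <= x_n, so that
    x_0 < w <= x_n.

    Hyperplanes of roots of a given length, counted separately, are monotone for
    the Bruhat order.  The chain x_0 < ... < x_n has unit steps along alpha,
    hence the count over the roots not as long as alpha is the same for x_0 and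
    x_n; therefore every reflection in a Bruhat chain from x_0 through w to x_n
    belongs to a root as long as alpha, and so does beta.  Only the roots of this
    length matter from now on: they form a rectangle (beta orthogonal to alpha) or
    a hexagon, beta = +-alpha being excluded directly.

    For every set M of vectors stable under the reflections in these roots, every
    p in an alcove of the smaller arrangement and a in A_0, the maximum of
    <x p - a, mu> over mu in M is monotone in x along the chain.  Take M to be the
    orbit of a vector lambda orthogonal to alpha with <beta, lambda> > 0, and p
    near the vertex opposite to the wall of s.  All x_t p have the same pairing
    with lambda, w p has a larger one, and the position of A_0 with respect to
    the walls at times n-1 and n shows that the maximum for x_n cannot catch up. *)

(** * Reflections of the plane *)

Section Plane.
Variable R : realType.
Notation E := 'rV[R]_2.
Implicit Types (u v b g : E) (k m : int).

Lemma dotE u v : dot u v = u 0 0 * v 0 0 + u 0 1 * v 0 1.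
Proof.
rewrite /dot mxE big_ord_recl big_ord1 !mxE.
by congr (_ * _ + _ * _); congr (_ _ _); apply/val_inj.
Qed.

Lemma rV2P u v : u 0 0 = v 0 0 -> u 0 1 = v 0 1 -> u = v.
Proof.
move=> e0 e1; apply/rowP => i; have [->//|->//] : i = 0 \/ i = 1.
by case: i => [[|[|//]] p]; [left|right]; apply/val_inj.
Qed.

Lemma dotC u v : dot u v = dot v u.
Proof. by rewrite !dotE; ring. Qed.
Lemma dotDl u v g : dot (u + v) g = dot u g + dot v g.
Proof. by rewrite !dotE !mxE; ring. Qed.
Lemma dotBl u v g : dot (u - v) g = dot u g - dot v g.
Proof. by rewrite !dotE !mxE; ring. Qed.
Lemma dotZl (x : R) v g : dot (x *: v) g = x * dot v g.
Proof. by rewrite !dotE !mxE; ring. Qed.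
Lemma dotNl v g : dot (- v) g = - dot v g.
Proof. by rewrite !dotE !mxE; ring. Qed.
Lemma dotDr u v g : dot g (u + v) = dot g u + dot g v.
Proof. by rewrite !dotE !mxE; ring. Qed.
Lemma dotBr u v g : dot g (u - v) = dot g u - dot g v.
Proof. by rewrite !dotE !mxE; ring. Qed.
Lemma dotZr (x : R) v g : dot g (x *: v) = x * dot g v.
Proof. by rewrite !dotE !mxE; ring. Qed.
Lemma dotNr v g : dot g (- v) = - dot g v.
Proof. by rewrite !dotE !mxE; ring. Qed.
Lemma dot0l v : dot 0 v = 0.
Proof. by rewrite dotE !mxE !mul0r addr0. Qed.
Definition dot_lin := (dotDl, dotBl, dotZl, dotNl, dotDr, dotBr, dotZr, dotNr).

Lemma dot_gt0 u : (0 < dot u u) = (u != 0).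
Proof.
rewrite dotE -!expr2 lt0r addr_ge0 ?sqr_ge0 // andbT; congr negb.
rewrite paddr_eq0 ?sqr_ge0 // !sqrf_eq0; apply/andP/eqP => [[/eqP a /eqP c]|->].
  by apply: rV2P; rewrite !mxE.
by rewrite !mxE.
Qed.

Lemma dot_coroot u b : dot u (coroot b) = 2 * dot u b / dot b b.
Proof. by rewrite /coroot dotZr mulrAC. Qed.

Lemma dot_coroot_self b : b != 0 -> dot b (coroot b) = 2.
Proof. by rewrite -dot_gt0 => h; rewrite dot_coroot mulfK ?gt_eqF. Qed.

Lemma corootN b : coroot (- b) = - coroot b.
Proof. by rewrite /coroot !dot_lin opprK scalerN. Qed.

Lemma reflE b k v : refl b k v = v - (dot v b - k%:~R) *: coroot b.
Proof. by []. Qed.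

Lemma dot_refl b k v g :
  dot (refl b k v) g = dot v g - (dot v b - k%:~R) * dot g (coroot b).
Proof. by rewrite reflE !dot_lin (dotC g). Qed.

Lemma dot_refl0C b v g : dot (refl b 0 v) g = dot v (refl b 0 g).
Proof.
rewrite dot_refl dotC [dot v (refl _ _ _)]dotC dot_refl !dot_coroot (dotC g v).
by ring.
Qed.

Lemma dot_refl_root b k v g :
  dot (refl b k v) g = dot v (refl b 0 g) + k%:~R * dot g (coroot b).
Proof. by rewrite -dot_refl0C !dot_refl; ring. Qed.

Lemma dot_refl_self b k v : b != 0 ->
  dot (refl b k v) b = k%:~R *+ 2 - dot v b.
Proof. by move=> b0; rewrite dot_refl dot_coroot_self //; ring. Qed.

Lemma reflK b k : b != 0 -> involutive (refl b k).
Proof.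
move=> b0 v; rewrite reflE dot_refl_self // reflE -addrA -opprD -scalerDl.
suff -> : dot v b - k%:~R + (k%:~R *+ 2 - dot v b - k%:~R) = 0.
  by rewrite scale0r subr0.
by ring.
Qed.

Lemma refl_comp b k : b != 0 -> refl b k \o refl b k = id.
Proof. by move=> b0; apply/funext => v /=; rewrite reflK. Qed.

Lemma refl_norm b u : b != 0 -> dot (refl b 0 u) (refl b 0 u) = dot u u.
Proof. by move=> b0; rewrite dot_refl0C reflK. Qed.

Lemma refl_fix b k v : dot v b = k%:~R -> refl b k v = v.
Proof. by move=> e; rewrite reflE e subrr scale0r subr0. Qed.

Lemma reflN b k : refl (- b) (- k) = refl b k.
Proof.
by apply/funext => v; apply: rV2P; rewrite !reflE corootN !dot_lin rmorphN !mxE; ring.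
Qed.

Lemma refl0N b : b != 0 -> refl b 0 b = - b.
Proof.
move=> b0; rewrite reflE subr0 /coroot scalerA.
have := b0; rewrite -dot_gt0 => h; rewrite mulrC divfK ?gt_eqF //.
by rewrite scalerDl scale1r opprD addrA subrr add0r.
Qed.

Lemma refl0_lin b (x y : R) u v :
  refl b 0 (x *: u + y *: v) = x *: refl b 0 u + y *: refl b 0 v.
Proof. by apply: rV2P; rewrite /refl !dot_lin !mxE; ring. Qed.

Lemma coroot_refl c b : c != 0 -> coroot (refl c 0 b) = refl c 0 (coroot b).
Proof.
move=> c0; rewrite /coroot refl_norm //.
have := refl0_lin c (2 / dot b b) 0 b 0.
by rewrite !scale0r !addr0.
Qed.

Lemma dot_refl_coroot c g : c != 0 ->
  dot (refl c 0 g) (coroot c) = - dot g (coroot c).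
Proof. by move=> c0; rewrite dot_refl0C -coroot_refl // refl0N // corootN dotNr. Qed.

Lemma refl_affine c l v (x : R) u :
  refl c l (v - x *: u) = refl c l v - x *: refl c 0 u.
Proof. by apply: rV2P; rewrite /refl !dot_lin !mxE; ring. Qed.

(** Conjugation moves the mirror by the conjugating reflection; integrality of the pairing [n] is
    what keeps the new level an integer. *)
Lemma refl_conj c l b k n : c != 0 -> dot b (coroot c) = n%:~R ->
  refl c l \o refl b k = refl (refl c 0 b) (k - l * n) \o refl c l.
Proof.
move=> c0 hn; apply/funext => v /=.
rewrite [refl b k v]reflE refl_affine -coroot_refl // [RHS]reflE.
congr (_ - _ *: _); rewrite dot_refl_root reflK // dot_refl0C.
rewrite [refl c 0 (coroot c)]reflE subr0 [dot (coroot c) c]dotC.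
by rewrite dotBr (dotZr (dot c _)) dot_coroot_self // hn rmorphB rmorphM /=; ring.
Qed.

Lemma refl_inj b k g m : b != 0 -> g != 0 -> refl b k = refl g m ->
  exists2 x : R, g = x *: b & m%:~R = x * k%:~R.
Proof.
move=> b0 g0 e.
have dg : dot g g != 0 by rewrite gt_eqF // dot_gt0.
have db : dot b b != 0 by rewrite gt_eqF // dot_gt0.
have e2 v : (dot v b - k%:~R) *: coroot b = (dot v g - m%:~R) *: coroot g.
  have := congr1 (fun f => f v) e; rewrite !reflE => /(congr1 (fun z => v - z)).
  by rewrite !subKr.
have e0 : k%:~R *: coroot b = m%:~R *: coroot g.
  by have := e2 0; rewrite !dot0l !sub0r !scaleNr => /oppr_inj.
have e1 v : dot v b *: coroot b = dot v g *: coroot g.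
  by have := e2 v; rewrite !scalerBl e0 => /addIr.
have gb : g = (dot g b / dot b b) *: b.
  have := e1 g; rewrite /coroot !scalerA => h.
  have : g = 2^-1 *: ((dot g g * (2 / dot g g)) *: g).
    by rewrite scalerA [_ * (_ / _)]mulrC divfK // mulVf ?scale1r // pnatr_eq0.
  rewrite -h scalerA => {1}->; congr (_ *: _); field; exact: db.
exists (dot g b / dot b b) => //.
move: e0 gb; set x := dot g b / dot b b => e0 gb.
have := congr1 (fun z => dot z g) e0.
rewrite /= (dotZl k%:~R) (dotZl m%:~R) !(dotC (coroot _)) dot_coroot_self // dot_coroot.
have -> : dot g b = x * dot b b by rewrite /x divfK.
move=> h; have : 2 * m%:~R = 2 * (x * k%:~R) :> R.
  by rewrite [LHS]mulrC -h; field; exact: db.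
by apply: mulfI; rewrite pnatr_eq0.
Qed.

End Plane.

(** * Counting separating hyperplanes *)

Section RootSystem.
Variables (R : realType) (Phi : seq 'rV[R]_2).
Hypothesis HPhi : root_system Phi.
Notation E := 'rV[R]_2.
Implicit Types (u v b g c : E) (k l m : int) (q : pred R) (w x : E -> E).

Lemma root_neq0 b : b \in Phi -> b != 0.
Proof. by case: HPhi => h _ _ _ _ bP; apply: contraNneq h => <-. Qed.

Lemma root_gt0 b : b \in Phi -> 0 < dot b b.
Proof. by move=> bP; rewrite dot_gt0 root_neq0. Qed.

Lemma root_refl b g : b \in Phi -> g \in Phi -> refl b 0 g \in Phi.
Proof. by case: HPhi => _ _ h _ _; apply: h. Qed.

Lemma opp_root b : b \in Phi -> - b \in Phi.
Proof. by move=> bP; rewrite -refl0N ?root_neq0 // root_refl. Qed.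

Lemma root_int g b : g \in Phi -> b \in Phi ->
  exists n : int, dot g (coroot b) = n%:~R.
Proof.
by case: HPhi => _ _ _ h _ gP bP; apply/intrP; rewrite dot_coroot h.
Qed.

Lemma root_mul b (r : R) : b \in Phi -> r *: b \in Phi -> r = 1 \/ r = -1.
Proof. by case: HPhi => _ _ _ _; apply. Qed.

(** For [v] off all hyperplanes, the integers [fl v g], [g] a root, are the address of its
    alcove. *)
Definition fl v g : int := Num.floor (dot v g).

Lemma fl_refl c l v g n : dot g (coroot c) = n%:~R ->
  fl (refl c l v) g = fl v (refl c 0 g) + l * n.
Proof.
move=> hn; rewrite /fl dot_refl_root hn -intrM floorDrz ?intr_int //.
by rewrite intrKfloor.
Qed.

Definition generic v := forall g, g \in Phi -> (fl v g)%:~R < dot v g.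

Lemma generic_refl c l v : c \in Phi -> generic v -> generic (refl c l v).
Proof.
move=> cP gv g gP; have [n hn] := root_int gP cP.
rewrite (fl_refl _ _ hn) dot_refl_root hn intrD intrM ltrD2r.
by apply: gv; apply: root_refl.
Qed.

Lemma fl_lt v g m : (fl v g < m) = (dot v g < m%:~R).
Proof. by rewrite /fl floor_lt_int. Qed.
Lemma fl_ge v g m : (m <= fl v g) = (m%:~R <= dot v g).
Proof. by rewrite /fl floor_ge_int. Qed.

Lemma flN v g : generic v -> g \in Phi -> fl v (- g) = - fl v g - 1.
Proof.
move=> gv gP; apply: floor_def; rewrite dotNr subrK.
have := gv _ gP; have := floorD1_gt (dot v g); rewrite -/(fl v g).
rewrite !intrD !intrN; lra.
Qed.

Lemma dot_gt_fl v g m : generic v -> g \in Phi ->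
  (m%:~R < dot v g) = (m <= fl v g).
Proof.
move=> gv gP; rewrite fl_ge le_eqVlt; case: eqP => //= e.
by have := gv _ gP; rewrite /fl -e intrKfloor ltxx.
Qed.

(* Each hyperplane is counted twice, once for each of its two roots. *)
Definition sep q u v : nat :=
  \sum_(g <- undup Phi | q (dot g g)) `|fl u g - fl v g|%N.

Lemma perm_refl c : c \in Phi ->
  perm_eq [seq refl c 0 g | g <- undup Phi] (undup Phi).
Proof.
move=> cP; have c0 := root_neq0 cP.
apply: uniq_perm; rewrite ?undup_uniq //.
  by rewrite map_inj_uniq ?undup_uniq //; apply: inv_inj (reflK 0 c0).
move=> g; rewrite mem_undup; apply/mapP/idP => [[h]|gP].
  by rewrite mem_undup => hP ->; apply: root_refl.
by exists (refl c 0 g); rewrite ?reflK // mem_undup root_refl.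
Qed.

(** The reflection permutes the roots and shifts each floor by an integer, so the sum can be
    reindexed. *)
Lemma sep_reflC q c l u v : c \in Phi ->
  sep q (refl c l u) v = sep q u (refl c l v).
Proof.
move=> cP; have c0 := root_neq0 cP.
rewrite /sep -(perm_big _ (perm_refl cP)) /= big_map.
rewrite (eq_bigl (fun g => q (dot g g))); last by move=> g; rewrite refl_norm.
rewrite big_seq_cond [RHS]big_seq_cond.
apply: eq_bigr => g /andP[]; rewrite mem_undup => gP _.
have [n hn] := root_int gP cP.
have hn' : dot (refl c 0 g) (coroot c) = (- n)%:~R.
  by rewrite dot_refl_coroot // hn intrN.
rewrite (fl_refl _ _ hn') (fl_refl _ _ hn) reflK //.
by lia.
Qed.

Lemma sep_refl q c l u v : c \in Phi ->
  sep q (refl c l u) (refl c l v) = sep q u v.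
Proof. by move=> cP; rewrite sep_reflC // reflK // root_neq0. Qed.

Lemma sepC q u v : sep q u v = sep q v u.
Proof. by apply: eq_bigr => g _; rewrite distnC. Qed.

Lemma sep_triangle q u v (z : E) : (sep q u z <= sep q u v + sep q v z)%N.
Proof. by rewrite /sep -big_split /=; apply: leq_sum => g _; lia. Qed.

Definition same_side b k u v : Prop :=
  0 < (dot u b - k%:~R) * (dot v b - k%:~R).

Lemma same_sideN b k u v : same_side b k u v -> same_side (- b) (- k) u v.
Proof. by rewrite /same_side !dotNr intrN -!opprD mulrNN. Qed.

Lemma neqN_root b : b \in Phi -> b != - b.
Proof.
move=> bP; apply: contraTneq (root_gt0 bP) => e.
have : dot b b = - dot b b by rewrite {1}e dotNl.
lra.
Qed.

(* Weighing u, v against their mirror images, each root contributes twice the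
   overlap of two intervals of integers, and the root of the mirror itself
   contributes at least 2. *)
Lemma sep_refl_ge q b k u v : b \in Phi -> generic u -> generic v ->
  same_side b k u v ->
  (sep q u v + (if q (dot b b) then 2 else 0) <= sep q u (refl b k v))%N.
Proof.
move=> bP gu gv.
(* Replacing [(b, k)] by [(- b, - k)] keeps the mirror and exchanges its two sides. *)
wlog below : b k bP / dot u b < k%:~R /\ dot v b < k%:~R.
  move=> H ss; have := ss; rewrite /same_side => ss'.
  have [ub|bu] := ltP (dot u b) k%:~R.
    apply: H => //; split=> //; rewrite -subr_lt0 in ub.
    by move: ss'; rewrite nmulr_rgt0 // subr_lt0.
  rewrite -(reflN b k) -[dot b b]opprK -dotNl -dotNr; apply: H; rewrite ?opp_root //.
    rewrite !dotNr intrN !ltrN2; move: ss'; rewrite -subr_ge0 in bu.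
    move: bu; rewrite le_eqVlt => /orP[/eqP <-|h]; first by rewrite mul0r ltxx.
    by rewrite pmulr_rgt0 // subr_gt0 -[k%:~R < dot u b]subr_gt0.
  exact: same_sideN.
move=> _.
set A := fl u; set V := fl v; set A' := fl (refl b k u); set V' := fl (refl b k v).
(* The mirror moves both points in the same direction along [g], given by the sign of [n]; matching
   lower ends together and upper ends together then costs least. *)
have key g : g \in Phi -> (`|A g - V g| + `|A' g - V' g| <= `|A g - V' g| + `|A' g - V g|)%N.
  move=> gP; have [n hn] := root_int gP bP.
  have mono z : dot z b < k%:~R ->
      (0 <= n -> fl z g <= fl (refl b k z) g) /\ (n <= 0 -> fl (refl b k z) g <= fl z g).
    move=> zb; split=> n0; apply: le_floor; rewrite dot_refl hn.
      suff : (dot z b - k%:~R) * n%:~R <= 0 by lra.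
      by rewrite mulr_le0_ge0 ?ler0z // subr_le0 ltW.
    suff : 0 <= (dot z b - k%:~R) * n%:~R by lra.
    by rewrite mulr_le0 ?lerz0 // subr_le0 ltW.
  have [mu mu'] := mono _ below.1; have [mv mv'] := mono _ below.2.
  have [n0|n0] := leP 0 n.
    by have := mu n0; have := mv n0; rewrite -/A -/A' -/V -/V'; lia.
  by have := mu' (ltW n0); have := mv' (ltW n0); rewrite -/A -/A' -/V -/V'; lia.
have keyb : (`|A b - V b| + `|A' b - V' b| + 2 <= `|A b - V' b| + `|A' b - V b|)%N.
  have b0 := root_neq0 bP.
  have low z : dot z b < k%:~R -> fl z b < k by rewrite fl_lt.
  have high z : dot z b < k%:~R -> k <= fl (refl b k z) b.
    by rewrite fl_ge dot_refl_self //; lra.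
  have := (low _ below.1); have := (low _ below.2).
  have := (high _ below.1); have := (high _ below.2).
  by rewrite -/A -/A' -/V -/V'; lia.
have keyNb : (`|A (- b)%R - V (- b)%R| + `|A' (- b)%R - V' (- b)%R| + 2 <=
    `|A (- b)%R - V' (- b)%R| + `|A' (- b)%R - V (- b)%R|)%N.
  rewrite /A /A' /V /V' !flN //; do ?[exact: generic_refl].
  by move: keyb; rewrite /A /A' /V /V'; lia.
have e1 : sep q u v = sep q (refl b k u) (refl b k v) by rewrite sep_refl.
have e2 : sep q u (refl b k v) = sep q (refl b k u) v by rewrite sep_reflC.
(* By [e1] and [e2] both sides are twice those of the goal; [b] and [- b] contribute 2 each. *)
suff : (sep q u v + sep q (refl b k u) (refl b k v) + (if q (dot b b) then 4 else 0)
        <= sep q u (refl b k v) + sep q (refl b k u) v)%N.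
  by rewrite -e1 -e2; case: ifP; lia.
rewrite /sep -!big_split /=.
case: ifP => qb; last first.
  rewrite addn0 big_seq_cond [leqRHS]big_seq_cond.
  by apply: leq_sum => g; rewrite mem_undup => /andP[gP _]; apply: key.
have bU : b \in undup Phi by rewrite mem_undup.
have NbU : - b \in undup Phi by rewrite mem_undup opp_root.
have bNb : (- b != b) by rewrite eq_sym neqN_root.
have NbU' : - b \in rem b (undup Phi) by rewrite mem_rem_uniq ?undup_uniq // inE bNb.
have qNb : q (dot (- b) (- b)) by rewrite dotNl dotNr opprK.
rewrite (big_rem b bU) [leqRHS](big_rem b bU) /= qb.
rewrite (big_rem _ NbU') [X in (_ <= _ + X)%N](big_rem _ NbU') /= qNb.
have : (\sum_(y <- rem (- b)%R (rem b (undup Phi)) | q (dot y y))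
          (`|A y - V y| + `|A' y - V' y|) <=
   \sum_(y <- rem (- b)%R (rem b (undup Phi)) | q (dot y y))
          (`|A y - V' y| + `|A' y - V y|))%N.
  rewrite big_seq_cond [leqRHS]big_seq_cond; apply: leq_sum => g /andP[gr _].
  by apply: key; have := mem_rem (mem_rem gr); rewrite mem_undup.
rewrite -/A -/A' -/V -/V'; move: keyb keyNb.
move: (\sum_(y <- _ | _) _)%N (\sum_(y <- _ | _) _)%N => S1 S2; lia.
Qed.

(* As [sep] counts each hyperplane twice, the bound 2 says that exactly one of
   them separates [v] from [v']. *)
Definition adjacent b k v v' : Prop :=
  [/\ b \in Phi, generic v, v' = refl b k v & (sep predT v v' <= 2)%N].

Lemma adjacent_refl c l b k v v' : c \in Phi -> adjacent b k v v' ->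
  exists2 n : int, dot b (coroot c) = n%:~R &
    adjacent (refl c 0 b) (k - l * n) (refl c l v) (refl c l v').
Proof.
move=> cP [bP gv -> s2]; have [n hn] := root_int bP cP; exists n => //.
split; rewrite ?root_refl ?sep_refl //; first exact: generic_refl.
exact: (congr1 (fun f => f v) (refl_conj l k (root_neq0 cP) hn)).
Qed.

Lemma adjacent_generic b k v v' : adjacent b k v v' -> generic v'.
Proof. by case=> bP gv -> _; apply: generic_refl. Qed.

Lemma adjacentC b k v v' : adjacent b k v v' -> adjacent b k v' v.
Proof.
move=> a; have gv' := adjacent_generic a; case: a => bP gv e s2; split => //.
  by rewrite e reflK // root_neq0.
by rewrite sepC.
Qed.

Lemma adjacentN b k v v' : adjacent b k v v' -> adjacent (- b) (- k) v v'.
Proof. by case=> bP gv e s2; split; rewrite ?opp_root ?reflN. Qed.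

(** The roots [b] and [- b] already exhaust the bound 2, so nothing is left for any other root. *)
Lemma adjacent_fl b k v v' : adjacent b k v v' -> dot v b < k%:~R ->
  [/\ fl v b = k - 1, fl v' b = k &
      forall g, g \in Phi -> g != b -> g != - b -> fl v g = fl v' g].
Proof.
move=> a vb; have gv' := adjacent_generic a; case: a => bP gv e s2.
have e' : dot v' b = k%:~R *+ 2 - dot v b by rewrite e dot_refl_self ?root_neq0.
have lo : fl v b < k by rewrite fl_lt.
have hi : k <= fl v' b by rewrite fl_ge e'; lra.
have bU : b \in undup Phi by rewrite mem_undup.
have NbU : - b \in undup Phi by rewrite mem_undup opp_root.
have NbU' : - b \in rem b (undup Phi).
  by rewrite mem_rem_uniq ?undup_uniq // inE eq_sym neqN_root.
move: s2; rewrite /sep (big_rem b bU) (big_rem _ NbU') /= !flN // => s2.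
split; [lia|lia|] => g gP gb gNb.
have gU : g \in rem (- b) (rem b (undup Phi)).
  rewrite mem_rem_uniq ?rem_uniq ?undup_uniq // inE gNb /=.
  by rewrite mem_rem_uniq ?undup_uniq // inE gb mem_undup.
move: s2; rewrite (big_rem _ gU) /=; lia.
Qed.

Lemma adjacent_sep b k v v' g m : adjacent b k v v' -> g \in Phi ->
  dot v g < m%:~R -> m%:~R < dot v' g -> refl g m = refl b k.
Proof.
move=> a gP vg v'g.
wlog vb : b k a / dot v b < k%:~R.
  move=> H; have [|bv] := ltP (dot v b) k%:~R; first exact: H.
  rewrite -(reflN b k); apply: H; first exact: adjacentN.
  have [bP gv _ _] := a; rewrite dotNr intrN ltrN2.
  by rewrite dot_gt_fl // fl_ge.
have [eb eb' eq] := adjacent_fl a vb; have gv' := adjacent_generic a.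
have [bP gv _ _] := a.
have fv : fl v g < m by rewrite fl_lt.
have fv' : m <= fl v' g by rewrite fl_ge ltW.
have [gb|gb] := eqVneq g b.
  by move: fv fv'; rewrite gb eb eb' => h1 h2; congr refl; lia.
have [gNb|gNb] := eqVneq g (- b).
  move: fv fv'; rewrite gNb !flN // eb eb' => h1 h2.
  by lia.
by move: fv fv'; rewrite (eq g) //; lia.
Qed.

Lemma refl_root b k g m : b \in Phi -> g \in Phi ->
  refl g m = refl b k -> (g = b /\ m = k) \/ (g = - b /\ m = - k).
Proof.
move=> bP gP /esym /(refl_inj (root_neq0 bP) (root_neq0 gP)) [r e em].
have rP : r *: b \in Phi by rewrite -e.
have [er|er] := root_mul bP rP; move: e em; rewrite er.
  by rewrite scale1r mul1r => -> /intr_inj ->; left.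
by rewrite scaleN1r mulN1r -intrN => -> /intr_inj ->; right.
Qed.

Lemma adjacent_sep1 b k v v' u : adjacent b k v v' -> generic u -> 
  same_side b k u v -> sep predT u v' = (sep predT u v + 2)%N.
Proof.
move=> a gu ss; have [bP gv e s2] := a; apply/eqP; rewrite eqn_leq; apply/andP.
split; last by rewrite e; have := sep_refl_ge predT bP gu gv ss.
by apply: leq_trans (sep_triangle _ _ v _) _; rewrite leq_add2l.
Qed.

End RootSystem.

(** * Properties valid for all sufficiently small positive parameters *)

Section Small.
Variable R : realType.
Implicit Types (x s t e : R).

Definition small (P : R -> Prop) := exists2 e : R, 0 < e & forall t, 0 < t < e -> P t.

Lemma small_and (P Q : R -> Prop) : small P -> small Q -> small (fun t => P t /\ Q t).
Proof.
move=> [e e0 he] [d d0 hd]; exists (Num.min e d); first by rewrite lt_min e0.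
by move=> t /andP[t0]; rewrite lt_min => /andP[te td]; split; [apply: he|apply: hd]; rewrite t0.
Qed.

Lemma small_all (T : eqType) (l : seq T) (P : T -> R -> Prop) :
  (forall g, g \in l -> small (P g)) -> small (fun t => forall g, g \in l -> P g t).
Proof.
elim: l => [|g l IH] h; first by exists 1.
have hl : small (fun t => forall g, g \in l -> P g t).
  by apply: IH => g' gl; apply: h; rewrite inE gl orbT.
have [e e0 he] := small_and (h g (mem_head _ _)) hl.
exists e => // t te g'; have [h1 h2] := he t te.
by rewrite inE => /orP[/eqP->|/h2].
Qed.

Lemma small_ex (P : R -> Prop) : small P -> exists t, P t.
Proof. by move=> [e e0 he]; exists (e / 2); apply: he; rewrite divr_gt0 //=; lra. Qed.

Lemma small_gt0 x s : 0 < x -> small (fun t => 0 < x + t * s).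
Proof.
move=> x0; have d0 : 0 < `|s| + 1 by rewrite ltr_wpDl.
exists (x / (`|s| + 1)); first by rewrite divr_gt0.
move=> t /andP[t0]; rewrite ltr_pdivlMr // => h.
have : - (t * s) <= t * `|s| by rewrite -mulrN ler_pM2l // ler_normr lexx orbT.
lra.
Qed.

Lemma small_neq0 x s : x != 0 \/ s != 0 -> small (fun t => x + t * s != 0).
Proof.
case: (eqVneq x 0) => [->|x0] h.
  have {h}s0 : s != 0 by case: h => //; rewrite eqxx.
  by exists 1 => // t /andP[t0 _]; rewrite add0r mulf_neq0 // gt_eqF.
have [x1|x1|] := ltgtP 0 x; last by move=> e; rewrite -e eqxx in x0.
  by have [e e0 he] := small_gt0 s x1; exists e => // t /he; apply: lt0r_neq0.
have : 0 < - x by lra.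
move=> /(small_gt0 (- s))[e e0 he]; exists e => // t /he.
by rewrite mulrN -opprD oppr_gt0 => /ltr0_neq0.
Qed.

(** A small move keeps [x] in the closed unit interval of the new floor; it ends at an integer only
    if [x] is one and [s] is 0. *)
Lemma small_floor x s : small (fun t =>
  ((Num.floor (x + t * s))%:~R <= x <= (Num.floor (x + t * s))%:~R + 1) /\
  ((Num.floor x)%:~R < x \/ s != 0 -> (Num.floor (x + t * s))%:~R < x + t * s)).
Proof.
have hf := floor_le x; have hf' := floorD1_gt x; rewrite intrD in hf'.
set f := Num.floor x in hf hf' *.
have up : 0 < f%:~R + 1 - x by lra.
have [fx|] := ltP f%:~R x.
  have lo : 0 < x - f%:~R by lra.
  have [e e0 he] := small_and (small_gt0 s lo) (small_gt0 (- s) up).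
  exists e => // t /he[h1 h2]; rewrite mulrN in h2.
  have -> : Num.floor (x + t * s) = f by apply: floor_def; rewrite intrD; lra.
  by split; lra.
move=> xf; have xfE : x = f%:~R by lra.
have [s0|s0|s0] := ltgtP 0 s.
- have [e e0 he] := small_gt0 (- s) up; exists e => // t th; have := he t th; rewrite mulrN => h.
  have ts : 0 < t * s by rewrite mulr_gt0 //; case/andP: th.
  have -> : Num.floor (x + t * s) = f by apply: floor_def; rewrite intrD; lra.
  by split; lra.
- have [e e0 he] := small_gt0 s ltr01; exists e => // t th; have := he t th => h.
  have ts : t * s < 0 by rewrite pmulr_rlt0 //; case/andP: th.
  have -> : Num.floor (x + t * s) = f - 1 by apply: floor_def; rewrite subrK intrB; lra.
  by rewrite intrB; split; lra.
- exists 1 => // t _; rewrite -s0 mulr0 addr0 -/f; split; first by lra.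
  by case=> [|/eqP//]; lra.
Qed.

Lemma seq_argmin (T : eqType) (l : seq T) (f : T -> R) g0 : g0 \in l ->
  exists2 g, g \in l & forall h, h \in l -> f g <= f h.
Proof.
elim: l g0 => [//|g l IH] g0 _.
case: l IH => [|g' l] IH; first by exists g; rewrite ?inE // => h; rewrite inE => /eqP->.
have [d dl hd] := IH g' (mem_head _ _).
have [le|le] := leP (f g) (f d).
  exists g; first by rewrite inE eqxx.
  by move=> h; rewrite inE => /orP[/eqP->//|/hd]; apply: le_trans.
exists d; first by rewrite inE dl orbT.
by move=> h; rewrite inE => /orP[/eqP->|/hd//]; apply: ltW.
Qed.
End Small.

(** * The affine Weyl group and the walls of the fundamental alcove *)

Section Group.
Variables (R : realType) (Phi : seq 'rV[R]_2).
Hypothesis HPhi : root_system Phi.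
Notation E := 'rV[R]_2.
Implicit Types (u v b g c : E) (k l m : int) (w x y : E -> E).

Lemma inW_id : inW Phi id.
Proof. by exists [::]; split. Qed.

Lemma inW_refl_l b k x : b \in Phi -> inW Phi x -> inW Phi (refl b k \o x).
Proof.
move=> bP [ts [h ->]]; exists (refl b k :: ts); split => //.
by constructor => //; exists b, k.
Qed.

Lemma inW_ind (P : (E -> E) -> Prop) : P id ->
  (forall b k x, b \in Phi -> inW Phi x -> P x -> P (refl b k \o x)) ->
  forall x, inW Phi x -> P x.
Proof.
move=> P0 Ps x [ts [h ->]] {x}; elim: h => [//|t {}ts [b [k [bP ->]]] h IH] /=.
by apply: Ps => //; exists ts.
Qed.

Lemma inW_comp x y : inW Phi x -> inW Phi y -> inW Phi (x \o y).
Proof.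
move=> hx hy; elim/inW_ind: x / hx => // b k x bP _ IH.
exact: (inW_refl_l k bP IH).
Qed.

Lemma inW_is_refl t : is_refl Phi t -> inW Phi t.
Proof. by move=> [b [k [bP ->]]]; exact: (inW_refl_l k bP inW_id). Qed.

Lemma inW_inv x : inW Phi x -> exists2 y, inW Phi y & x \o y = id /\ y \o x = id.
Proof.
elim/inW_ind => [|b k {}x bP hx [y hy [xy yx]]]; first by exists id; first exact: inW_id.
have hb := refl_comp k (root_neq0 HPhi bP).
exists (y \o refl b k); first by apply: inW_comp => //; apply: inW_is_refl; exists b, k.
split.
  rewrite -[LHS]/(refl b k \o (x \o y) \o refl b k) xy; exact: hb.
rewrite -[LHS]/(y \o (refl b k \o refl b k) \o x) hb; exact: yx.
Qed.

(** Turns the right multiplications of the Bruhat order into reflections acting on alcoves from the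
    left. *)
Lemma inW_conj x b k : inW Phi x -> b \in Phi ->
  exists b' k', b' \in Phi /\ x \o refl b k = refl b' k' \o x.
Proof.
move=> hx bP; elim/inW_ind: x / hx => [|c l x cP hx [b' [k' [b'P e]]]]; first by exists b, k.
have [n hn] := root_int HPhi b'P cP.
exists (refl c 0 b'), (k' - l * n); split; first exact: root_refl.
rewrite -[LHS]/(refl c l \o (x \o refl b k)) e.
by rewrite -[LHS]/((refl c l \o refl b' k') \o x) (refl_conj l k' (root_neq0 HPhi cP) hn).
Qed.

Lemma inW_generic x v : inW Phi x -> generic Phi v -> generic Phi (x v).
Proof.
move=> hx gv; elim/inW_ind: x / hx => // b k x bP _ IH /=.
exact: generic_refl.
Qed.

Lemma inW_sep q x u v : inW Phi x -> sep Phi q (x u) (x v) = sep Phi q u v.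
Proof. by move=> hx; elim/inW_ind: x / hx => // b k x bP _ IH /=; rewrite sep_refl. Qed.

(** For generic [v], this is membership of [z] in the closed alcove of [v]. *)
Definition near z v := forall g, g \in Phi -> (fl v g)%:~R <= dot z g <= (fl v g)%:~R + 1.

Lemma near_refl c l z v : c \in Phi -> near z v -> near (refl c l z) (refl c l v).
Proof.
move=> cP nz g gP; have [n hn] := root_int HPhi gP cP.
rewrite (fl_refl _ _ hn) dot_refl_root hn intrD intrM.
by have := nz _ (root_refl HPhi cP gP); lra.
Qed.

(** Uniqueness is expressed through reflections because [(b, k)] and [(- b, - k)] name the same
    hyperplane. *)
Definition only_on z (r : E -> E) :=
  exists b k, [/\ b \in Phi, r = refl b k, dot z b = k%:~R &
    forall g m, g \in Phi -> dot z g = m%:~R -> refl g m = r].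

Lemma only_on_refl c l z r : c \in Phi -> only_on z r ->
  only_on (refl c l z) (refl c l \o r \o refl c l).
Proof.
move=> cP [b [k [bP -> zb H]]]; have [n hn] := root_int HPhi bP cP.
have c0 := root_neq0 HPhi cP.
have conj g m p : dot g (coroot c) = p%:~R ->
    refl c l \o refl g m \o refl c l = refl (refl c 0 g) (m - l * p).
  by move=> hp; rewrite (refl_conj l m c0 hp) -[LHS]/(_ \o (refl c l \o refl c l)) refl_comp.
have cn g p : dot g (coroot c) = p%:~R -> dot (refl c 0 g) (coroot c) = (- p)%:~R.
  by move=> hp; rewrite dot_refl_coroot // hp intrN.
exists (refl c 0 b), (k - l * n); split; first exact: root_refl.
- exact: conj.
- by rewrite dot_refl_root reflK // zb (cn _ _ hn) intrB intrM intrN; ring.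
move=> g m gP; have [p hp] := root_int HPhi gP cP.
rewrite dot_refl_root hp => zg.
rewrite -(H (refl c 0 g) (m - l * p)) ?root_refl //; last first.
  by rewrite intrB intrM -zg; ring.
rewrite (conj _ _ (- p)) ?(cn _ _ hp) // reflK //; congr refl; ring.
Qed.

(** The explicit vector is [b] turned by a quarter; in the plane its orthogonal is the line of
    [b]. *)
Lemma perp_dot b g : b != 0 ->
  dot (\row_(i < 2) if i == 0 then - b 0 1 else b 0 0) g = 0 ->
  g = (dot g b / dot b b) *: b.
Proof.
rewrite -dot_gt0 => b0; rewrite dotE !mxE /= => h.
have b1 : dot b b != 0 by rewrite gt_eqF.
have e i : g 0 i * dot b b = dot g b * b 0 i -> g 0 i = (dot g b / dot b b) * b 0 i.
  by move=> e; apply: (mulIf b1); rewrite e; field.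
have h2 : b 0 0 * g 0 1 = b 0 1 * g 0 0 by lra.
apply: rV2P; rewrite [RHS]mxE; apply: e; rewrite !dotE.
  transitivity (g 0 0 * b 0 0 * b 0 0 + b 0 1 * (b 0 1 * g 0 0)); first by ring.
  by rewrite -h2; ring.
transitivity (g 0 1 * b 0 1 * b 0 1 + b 0 0 * (b 0 0 * g 0 1)); first by ring.
by rewrite h2; ring.
Qed.

(** Sliding a point slightly along the hyperplane takes it off all hyperplanes not parallel to it; a
    further small push along [b] enters an alcove touching the point. *)
Lemma only_on_point b k : b \in Phi -> exists z v,
  [/\ only_on z (refl b k), generic Phi v & near z v].
Proof.
move=> bP; have b0 := root_neq0 HPhi bP; have bb := root_gt0 HPhi bP.
set p : E := \row_(i < 2) if i == 0 then - b 0 1 else b 0 0.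
set z0 : E := (k%:~R / dot b b) *: b.
have z0b : dot z0 b = k%:~R by rewrite dotZl divfK ?gt_eqF.
have pb : dot p b = 0 by rewrite dotE !mxE /=; ring.
have [|t ht] := small_ex (small_all (l := Phi)
    (P := fun g t => dot p g != 0 -> (fl (z0 + t *: p) g)%:~R < dot (z0 + t *: p) g) _).
  move=> g gP; have [e e0 he] := small_floor (dot z0 g) (dot p g).
  exists e => // t /he[_ h] pg; rewrite /fl dotDl dotZl; apply: h; right=> //.
set z := z0 + t *: p in ht.
have zb : dot z b = k%:~R by rewrite dotDl dotZl pb mulr0 addr0.
have par g m : g \in Phi -> dot p g = 0 -> dot z g = m%:~R -> refl g m = refl b k.
  move=> gP /(perp_dot b0) ge zg; move: (ge); set r := _ / _ => {}ge.
  have rP : r *: b \in Phi by rewrite -ge.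
  have [er|er] := root_mul HPhi bP rP; move: zg; rewrite ge er.
    by rewrite scale1r zb => /intr_inj ->.
  by rewrite scaleN1r dotNr zb -intrN => /intr_inj <-; rewrite reflN.
have [|s hs] := small_ex (small_all (l := Phi) (P := fun g s =>
   (fl (z + s *: b) g)%:~R < dot (z + s *: b) g /\
   ((fl (z + s *: b) g)%:~R <= dot z g <= (fl (z + s *: b) g)%:~R + 1)) _).
  move=> g gP; have [e e0 he] := small_floor (dot z g) (dot b g).
  exists e => // s /he[h1 h2]; rewrite /fl dotDl dotZl; split => //; apply: h2.
  have [pg|pg] := eqVneq (dot p g) 0; last by left; apply: ht.
  right; apply: contraTneq (root_gt0 HPhi gP) => bg.
  by rewrite {1}(perp_dot b0 pg) dotZl bg mulr0 ltxx.
exists z, (z + s *: b); split; last by move=> g /hs[].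
  exists b, k; split => // g m gP zg.
  have [pg|pg] := eqVneq (dot p g) 0; first exact: par.
  by have := ht _ gP pg; rewrite /fl zg intrKfloor ltxx.
by move=> g /hs[].
Qed.

Variable rho : E.
Hypothesis Hrho : regular Phi rho.

Lemma A0_nonempty : exists a, A0 Phi rho a.
Proof.
have [|t h] := small_ex (small_all (l := Phi)
   (P := fun g t => 0 < t /\ 0 < 1 + t * (- dot g rho)) _).
  move=> g gP; have [e e0 he] := small_gt0 (- dot g rho) ltr01.
  by exists e => // t te; split; [case/andP: te|apply: he].
exists (t *: rho) => b bP b0; have [t0 tb] := h b bP.
by rewrite dotZl (dotC rho) mulr_gt0 //=; lra.
Qed.

Variable a : E.
Hypothesis Ha : A0 Phi rho a.

Lemma A0_fl g : g \in Phi -> fl a g = if 0 < dot g rho then 0 else -1.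
Proof.
move=> gP; case: ifP => g0; apply: floor_def.
  by have := Ha gP g0; rewrite add0r; lra.
have : 0 < dot (- g) rho by rewrite dotNl oppr_gt0 lt_neqAle Hrho //= leNgt g0.
move=> /(Ha (opp_root HPhi gP)); rewrite dotNr addNr intrN; lra.
Qed.

Lemma A0_generic : generic Phi a.
Proof.
move=> g gP; rewrite A0_fl //; case: ifP => g0.
  by have := Ha gP g0; lra.
have : 0 < dot (- g) rho by rewrite dotNl oppr_gt0 lt_neqAle Hrho //= leNgt g0.
by move=> /(Ha (opp_root HPhi gP)); rewrite dotNr intrN; lra.
Qed.

Lemma A0_closure_near z : A0_closure Phi rho z <-> near z a.
Proof.
split=> [h g gP|h g gP g0].
  rewrite A0_fl //; case: ifP => g0; first by have := h _ gP g0; lra.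
  have : 0 < dot (- g) rho by rewrite dotNl oppr_gt0 lt_neqAle Hrho //= leNgt g0.
  by move=> /(h _ (opp_root HPhi gP)); rewrite dotNr intrN; lra.
by have := h _ gP; rewrite A0_fl // g0; lra.
Qed.

Lemma simple_reflP s : simple_refl Phi rho s <->
  exists2 z, near z a & only_on z s.
Proof.
split=> [[b [k [bP -> [z [zA zb H]]]]]|[z /A0_closure_near zA [b [k [bP -> zb H]]]]].
  by exists z; [apply/A0_closure_near|exists b, k].
by exists b, k; split => //; exists z.
Qed.

(** The point [z] of the wall is fixed by the reflection, hence lies in the closures of both
    alcoves; a hyperplane between them must pass through [z]. *)
Lemma simple_sep b k g m : b \in Phi -> g \in Phi -> simple_refl Phi rho (refl b k) ->
  dot a g < m%:~R < dot (refl b k a) g -> refl g m = refl b k.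
Proof.
move=> bP gP /simple_reflP[z za [b' [k' [b'P e zb H]]]] /andP[ag bg].
have zfix : refl b k z = z by rewrite e refl_fix.
apply: H => //; apply/le_anti/andP; split.
  have := za _ gP => /andP[_ h]; apply: le_trans h _.
  have -> : (fl a g)%:~R + 1 = (fl a g + 1)%:~R :> R by rewrite intrD.
  by move: ag; rewrite -fl_lt ler_int; lia.
have [n hn] := root_int HPhi gP bP.
have := za _ (root_refl HPhi bP gP) => /andP[h _].
rewrite -zfix dot_refl_root hn -lerBlDr; apply: le_trans h.
move: bg; rewrite dot_refl_root hn -intrM -ltrBlDr -intrB => /ltW.
by rewrite -fl_ge ler_int.
Qed.

Lemma simple_adjacent s : simple_refl Phi rho s ->
  exists b k, s = refl b k /\ adjacent Phi b k a (s a).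
Proof.
move=> hs; have [b [k [bP es _]]] := hs; rewrite es in hs *.
exists b, k; split => //; split => //; first exact: A0_generic.
have ga := A0_generic; have gs := generic_refl HPhi (c := b) k bP ga.
have lt1 g : g \in Phi -> fl a g < fl (refl b k a) g ->
    (g = b \/ g = - b) /\ fl (refl b k a) g = fl a g + 1.
  move=> gP h.
  have sepg m : fl a g < m -> m <= fl (refl b k a) g -> refl g m = refl b k.
    by move=> h1 h2; apply: simple_sep => //; rewrite -fl_lt h1 (dot_gt_fl _ gs).
  have e1 := sepg _ h (lexx _); split.
    by case: (refl_root HPhi bP gP e1) => [[]|[]]; [left|right].
  have [//|lt2] := eqVneq (fl (refl b k a) g) (fl a g + 1).
  have e2 : refl g (fl a g + 1) = refl b k by apply: sepg; lia.
  case: (refl_root HPhi gP gP (etrans e2 (esym e1))) => [[_ e]|[gN _]].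
    by rewrite e eqxx in lt2.
  by have := neqN_root HPhi gP; rewrite {1}gN eqxx.
have le1 g : g \in Phi -> (`|fl a g - fl (refl b k a) g| <= (g == b) + (g == - b)%R)%N.
  move=> gP; have [lt|lt|->] := ltgtP (fl a g) (fl (refl b k a) g); last by rewrite subrr.
    by have [[->|->] ->] := lt1 g gP lt; rewrite eqxx; lia.
  have := lt1 _ (opp_root HPhi gP); rewrite !(flN (Phi := Phi)) // => /(_ ltac:(lia)) [h1 h2].
  have : (g == b) || (g == - b).
    by case: h1 => [<-|/oppr_inj ->]; rewrite ?opprK eqxx ?orbT.
  by lia.
rewrite /sep big_seq_cond.
apply: (@leq_trans (\sum_(g <- undup Phi) ((g == b) + (g == - b)%R))%N).
  rewrite [leqRHS]big_seq_cond; apply: leq_sum => g; rewrite mem_undup => /andP[gP _].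
  exact: le1.
rewrite big_split /=.
have cnt c : (\sum_(g <- undup Phi) (g == c) <= 1)%N.
  rewrite (eq_bigr (fun g => if g == c then 1 else 0)%N); last by move=> g _; case: eqP.
  by rewrite -big_mkcond sum1_count count_uniq_mem ?undup_uniq //; case: (_ \in _).
by rewrite -[leqRHS]/(1 + 1)%N leq_add.
Qed.

Lemma simple_inW s : simple_refl Phi rho s -> inW Phi s.
Proof. by move=> [b [k [bP -> _]]]; apply: inW_is_refl; exists b, k. Qed.

Lemma simple_invol s : simple_refl Phi rho s -> s \o s = id.
Proof. by move=> [b [k [bP -> _]]]; exact: refl_comp (root_neq0 HPhi bP). Qed.

(** Right multiplication by a simple reflection crosses a wall of the alcove itself: the image under
    [x] of a wall of the fundamental alcove. *)
Lemma adjacent_right x s : inW Phi x -> simple_refl Phi rho s ->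
  exists b k, x \o s = refl b k \o x /\ adjacent Phi b k (x a) (x (s a)).
Proof.
move=> hx /simple_adjacent [b [k [-> [bP ga _ s2]]]].
have [b' [k' [b'P e]]] := inW_conj k hx bP.
exists b', k'; split => //; split => //; first exact: inW_generic.
  exact: (congr1 (fun f => f a) e).
by rewrite (inW_sep _ _ _ hx).
Qed.

Definition opp_side b k u v : Prop := (dot u b - k%:~R) * (dot v b - k%:~R) < 0.

Lemma side_cases b k u v : b \in Phi -> generic Phi u -> generic Phi v ->
  same_side b k u v \/ opp_side b k u v.
Proof.
move=> bP gu gv; rewrite /same_side /opp_side.
have ne z : generic Phi z -> dot z b - k%:~R != 0.
  move=> gz; rewrite subr_eq0; apply: contraTneq (gz _ bP) => e.
  by rewrite /fl e intrKfloor ltxx.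
have := mulf_neq0 (ne _ gu) (ne _ gv).
by rewrite neq_lt => /orP[|]; [right|left].
Qed.

(* Seen from a perturbed point of the alcove, no two non-parallel hyperplanes are
   crossed simultaneously, so the first one crossed is a wall. *)
Lemma exists_wall v : generic Phi v -> sep Phi predT a v != 0%N ->
  exists b k, [/\ b \in Phi, simple_refl Phi rho (refl b k) & opp_side b k a v].
Proof.
move=> gv s0; have ga := A0_generic.
(* Height above the hyperplane just below [a] along [g]; hyperplanes just above are treated as those
   just below along [- g]. *)
pose psi g (y : E) := dot y g - (fl a g)%:~R.
(* The segment from [y] to [v] can cross the hyperplanes of [d] and [g] simultaneously only if
   [phi d g y], defined below, vanishes; [nrm d g] is the gradient of this affine function of
   [y]. *)
pose nrm d g : E := psi g v *: d - psi d v *: g.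
have psi_v g : g \in Phi -> psi g v != 0.
  move=> gP; rewrite subr_eq0; apply: contraTneq (gv _ gP) => e.
  by rewrite /fl e intrKfloor ltxx.
(* A direction [(1, r)] orthogonal to none of the finitely many nonzero gradients. *)
have [|r hr] := small_ex (small_all (l := [seq (d, g) | d <- Phi, g <- Phi])
  (P := fun p r => nrm p.1 p.2 != 0 -> (nrm p.1 p.2) 0 0 + r * (nrm p.1 p.2) 0 1 != 0) _).
  move=> [d g] _ /=; have [->|n0] := eqVneq (nrm d g) 0; first by exists 1.
  have [|e e0 he] := @small_neq0 _ ((nrm d g) 0 0) ((nrm d g) 0 1).
    have [h0|] := eqVneq ((nrm d g) 0 0) 0; last by left.
    have [h1|] := eqVneq ((nrm d g) 0 1) 0; last by right.
    by case/eqP: n0; apply: rV2P; rewrite [RHS]mxE.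
  by exists e => // t /he.
pose dir : E := \row_(i < 2) if i == 0 then 1 else r.
have hdir d g : d \in Phi -> g \in Phi -> nrm d g != 0 -> dot dir (nrm d g) != 0.
  move=> dP gP n0; rewrite dotE !mxE /= mul1r.
  have := hr (d, g); rewrite /= !mxE; apply => //.
  by apply/allpairsP; exists (d, g).
pose phi d g (y : E) := psi d y * psi g v - psi g y * psi d v.
have phiE d g (y : E) t : phi d g (y + t *: dir) = phi d g y + t * dot dir (nrm d g).
  by rewrite /phi /nrm /psi !dot_lin; ring.
have [|t ht] := small_ex (small_all (l := [seq (d, g) | d <- Phi, g <- Phi])
  (P := fun p t => 0 < psi p.1 (a + t *: dir) /\
     (nrm p.1 p.2 != 0 -> phi p.1 p.2 (a + t *: dir) != 0)) _).
  move=> [d g] /allpairsP[[d' g'] /= [dP gP [-> ->]]] {d g}.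
  have p0 : 0 < psi d' a by rewrite subr_gt0; apply: ga.
  have [e1 e10 h1] := small_gt0 (dot dir d') p0.
  have [n0|n0] := eqVneq (nrm d' g') 0.
    exists e1 => // t /h1 h; split => //.
    by move: h; rewrite /psi !dot_lin addrAC.
  have [e e0 he] := small_and (small_gt0 (dot dir d') p0)
    (small_neq0 (x := phi d' g' a) (or_intror (hdir _ _ dP gP n0))).
  exists e => // t /he[h h']; split; last by rewrite phiE.
  by move: h; rewrite /psi !dot_lin addrAC.
move: ht; set y := a + t *: dir => ht.
have y0 g : g \in Phi -> 0 < psi g y.
  by move=> gP; apply: (ht (g, g) _).1; apply/allpairsP; exists (g, g).
have yphi d g : d \in Phi -> g \in Phi -> nrm d g != 0 -> phi d g y != 0.
  by move=> dP gP; apply: (ht (d, g) _).2; apply/allpairsP; exists (d, g).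
have [g0 g0P] : exists g, g \in [seq g <- Phi | psi g v < 0].
  have [/hasP[g gP gn]|/hasPn h] := boolP (has (fun g => psi g v < 0) Phi).
    by exists g; rewrite mem_filter gn.
  case/eqP: s0; rewrite /sep big_seq_cond big1 // => g /andP[]; rewrite mem_undup => gP _.
  have pos b : b \in Phi -> fl a b <= fl v b.
    by move=> bP; have := h _ bP; rewrite -leNgt subr_ge0 -fl_ge.
  by have := pos _ gP; have := pos _ (opp_root HPhi gP); rewrite !(flN (Phi := Phi)) //; lia.
(* The time at which the segment from [y] to [v] crosses the hyperplane of [g]; the first one
   crossed is that of [d], at the point [p]. *)
pose tau g := psi g y / (psi g y - psi g v).
have [d] := seq_argmin tau g0P; rewrite mem_filter => /andP[dn dP] dmin.
have tauE g : psi g v < 0 -> g \in Phi -> tau g * (psi g y - psi g v) = psi g y.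
  by move=> gn gP; have := y0 _ gP => yg; rewrite divfK // gt_eqF //; lra.
have t0 : 0 < tau d by rewrite divr_gt0 ?y0 //; have := y0 _ dP; lra.
have t1 : tau d < 1 by rewrite ltr_pdivrMr; have := y0 _ dP; lra.
pose p := y + tau d *: (v - y).
have psip g : psi g p = psi g y - tau d * (psi g y - psi g v).
  by rewrite /psi /p !dot_lin; ring.
have pd : psi d p = 0 by rewrite psip tauE // subrr.
have p_ge0 g : g \in Phi -> 0 <= psi g p.
  move=> gP; rewrite psip; have [gn|gp] := ltP (psi g v) 0.
    rewrite -{1}(tauE g) // -mulrBl mulr_ge0 //; last by have := y0 _ gP; lra.
    by rewrite subr_ge0; apply: dmin; rewrite mem_filter gn.
  have -> : psi g y - tau d * (psi g y - psi g v) = (1 - tau d) * psi g y + tau d * psi g v by ring.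
  by rewrite addr_ge0 // mulr_ge0 //; have := y0 _ gP; lra.
(* A nonzero [nrm d g] contradicts the choice of [y]; a zero one makes [g] a multiple of [d], hence
   [d] or [- d]. *)
have par g m : g \in Phi -> psi g p = 0 -> dot p g = m%:~R -> refl g m = refl d (fl a d).
  move=> gP pg pgm; have [n0|n0] := eqVneq (nrm d g) 0; last first.
    case/eqP: (yphi _ _ dP gP n0); apply: (mulfI (lt0r_neq0 t0)); rewrite mulr0 /phi.
    have e1 : tau d * psi d v = tau d * psi d y - psi d y by have := pd; rewrite psip; lra.
    have e2 : tau d * psi g v = tau d * psi g y - psi g y by have := pg; rewrite psip; lra.
    transitivity (psi d y * (tau d * psi g v) - psi g y * (tau d * psi d v)); first by ring.
    by rewrite e1 e2; ring.
  have dv : psi d v != 0 by apply: psi_v.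
  have ge : g = (psi g v / psi d v) *: d.
    move/eqP: n0; rewrite subr_eq0 => /eqP n0.
    by rewrite mulrC -scalerA n0 scalerA mulVf // scale1r.
  move: ge; set c := _ / _ => ge; have cP : c *: d \in Phi by rewrite -ge.
  have pd' : dot p d = (fl a d)%:~R by apply/eqP; rewrite -subr_eq0; apply/eqP.
  have [ec|ec] := root_mul HPhi dP cP; move: pgm; rewrite ge ec.
    by rewrite scale1r pd' => /intr_inj ->.
  by rewrite scaleN1r dotNr pd' -intrN => /intr_inj <-; rewrite reflN.
have flNa g : g \in Phi -> (fl a (- g))%:~R = - (fl a g)%:~R - 1 :> R.
  by move=> gP; rewrite (flN (Phi := Phi)) // intrB intrN.
exists d, (fl a d); split => //; last first.
  have := dn; have : 0 < psi d a by rewrite subr_gt0; apply: ga.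
  by rewrite /opp_side => h1 h2; rewrite pmulr_rlt0.
apply/simple_reflP; exists p.
  move=> g gP; have := p_ge0 _ gP; have := p_ge0 _ (opp_root HPhi gP).
  by rewrite /psi dotNr flNa //; lra.
exists d, (fl a d); split => //; first by apply/eqP; rewrite -subr_eq0; apply/eqP.
(* A hyperplane through [p] bounds the strip of [a] along [g] from below or from above; the second
   case is the first one for [- g]. *)
move=> g m gP pgm; have [pg|pg] := eqVneq (psi g p) 0; first exact: par.
rewrite -reflN; apply: par; first exact: opp_root.
  have := p_ge0 _ gP; have := p_ge0 _ (opp_root HPhi gP).
  rewrite /psi dotNr flNa // pgm => h1 h2.
  have h3 : m <= fl a g + 1 by rewrite -(ler_int R) intrD; lra.
  have h4 : fl a g <= m by rewrite -(ler_int R); lra.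
  have h5 : m != fl a g by apply: contraNneq pg => e; rewrite /psi pgm e subrr.
  have -> : m = fl a g + 1 by lia.
  by rewrite intrD; ring.
by rewrite dotNr pgm intrN.
Qed.
End Group.

(** * Coxeter length *)

Section Length.
Variables (R : realType) (Phi : seq 'rV[R]_2).
Hypothesis HPhi : root_system Phi.
Notation E := 'rV[R]_2.
Variable rho : E.
Hypothesis Hrho : regular Phi rho.
Variable a : E.
Hypothesis Ha : A0 Phi rho a.
Implicit Types (u v z b g c : E) (k l : int) (r s w x y : E -> E).

Let ga : generic Phi a := A0_generic HPhi Hrho Ha.

Lemma word0 : word_len Phi rho id 0.
Proof. by exists [::]; split. Qed.

Lemma word0_inv x : word_len Phi rho x 0 -> x = id.
Proof. by move=> [ss [/size0nil -> _ ->]]. Qed.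

Lemma word_cons s x n : simple_refl Phi rho s -> word_len Phi rho x n ->
  word_len Phi rho (s \o x) n.+1.
Proof.
by move=> hs [ss [<- h ->]]; exists (s :: ss); split => //; constructor.
Qed.

Lemma word_cons_inv x n : word_len Phi rho x n.+1 -> exists s y,
  [/\ simple_refl Phi rho s, word_len Phi rho y n & x = s \o y].
Proof.
move=> [[|s ss] [// [sz] h ->]]; exists s, (foldr comp id ss).
by split => //; [inversion h|exists ss; split => //; inversion h].
Qed.

Lemma word_cat x y n m : word_len Phi rho x n -> word_len Phi rho y m ->
  word_len Phi rho (x \o y) (n + m).
Proof.
elim: n x => [|n IH] x; first by move=> /word0_inv ->.
move=> /word_cons_inv[s [x' [hs hx' ->]]] hy.
by rewrite addSn; exact: (word_cons hs (IH _ hx' hy)).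
Qed.

Lemma word_inW x n : word_len Phi rho x n -> inW Phi x.
Proof.
elim: n x => [|n IH] x; first by move=> /word0_inv ->; exact: inW_id.
move=> /word_cons_inv[s [x' [hs /IH hx' ->]]].
by apply: inW_comp => //; apply: simple_inW hs.
Qed.

Lemma opp_side_refl b k u v : b \in Phi -> opp_side b k u v ->
  same_side b k u (refl b k v).
Proof.
move=> bP; rewrite /opp_side /same_side dot_refl_self ?(root_neq0 HPhi) // => h.
have -> : k%:~R *+ 2 - dot v b - k%:~R = - (dot v b - k%:~R) by ring.
by rewrite mulrN oppr_gt0.
Qed.

Lemma sep_refl_le b k u v : b \in Phi -> generic Phi u -> generic Phi v ->
  opp_side b k u v -> (sep Phi predT u (refl b k v) + 2 <= sep Phi predT u v)%N.
Proof.
move=> bP gu gv /(opp_side_refl bP) ss.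
have := sep_refl_ge HPhi predT bP gu (generic_refl HPhi k bP gv) ss.
by rewrite reflK // (root_neq0 HPhi).
Qed.

(** Induction on the distance from [a] to an alcove touching the mirror: conjugating by a wall of
    the fundamental alcove that separates them brings it closer, and at distance 0 the reflection is
    simple. *)
Lemma word_only_on z v r : only_on Phi z r -> generic Phi v -> near Phi z v ->
  exists n, word_len Phi rho r n.
Proof.
have [N] := ubnP (sep Phi predT a v); elim: N => // N IH in z v r *.
move=> hN zr gv zv; have [s0|s0] := eqVneq (sep Phi predT a v) 0%N.
  exists 1%N; rewrite -[r]/(r \o id); apply: word_cons word0.
  apply/(simple_reflP HPhi Hrho Ha); exists z => // g gP.
  suff -> : fl a g = fl v g by apply: zv.
  move: s0; rewrite /sep (big_rem g) ?mem_undup //=; lia.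
have [b [k [bP hs op]]] := exists_wall HPhi Hrho Ha gv s0.
have lt := sep_refl_le bP ga gv op.
have [|n hn] := IH _ _ _ _ (only_on_refl HPhi k bP zr) (generic_refl HPhi k bP gv)
   (near_refl HPhi k bP zv); first by lia.
exists (1 + n + 1)%N; have ss := refl_comp k (root_neq0 HPhi bP).
have -> : r = refl b k \o (refl b k \o r \o refl b k) \o refl b k.
  rewrite -[RHS]/((refl b k \o refl b k) \o r \o (refl b k \o refl b k)).
  by rewrite ss.
have w1 : word_len Phi rho (refl b k) 1.
  by rewrite -[refl b k]/(refl b k \o id); apply: word_cons word0.
by do !apply: word_cat.
Qed.

Lemma inW_word x : inW Phi x -> exists n, word_len Phi rho x n.
Proof.
elim/inW_ind => [|b k {}x bP _ [n hn]]; first by exists 0%N; exact: word0.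
have [z [v [zr gv zv]]] := only_on_point HPhi k bP.
have [m hm] := word_only_on zr gv zv.
by exists (m + n)%N; apply: word_cat.
Qed.

Lemma opp_sideP b k u v : opp_side b k u v ->
  (dot u b < k%:~R /\ k%:~R < dot v b) \/ (dot v b < k%:~R /\ k%:~R < dot u b).
Proof.
rewrite /opp_side; have [h|h|->] := ltrgtP (dot u b - k%:~R) 0;
    last by rewrite mul0r ltxx.
  by rewrite nmulr_rlt0 // => h'; left; lra.
by rewrite pmulr_rlt0 // => h'; right; lra.
Qed.

Lemma adjacent_opp b k v v' g m : adjacent Phi b k v v' -> g \in Phi ->
  opp_side g m v v' -> refl g m = refl b k.
Proof.
move=> ad gP /opp_sideP[[h1 h2]|[h1 h2]]; first exact: (adjacent_sep HPhi ad gP h1 h2).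
exact: (adjacent_sep HPhi (adjacentC HPhi ad) gP h1 h2).
Qed.

Lemma side_trans b k u v z : same_side b k u v -> opp_side b k u z -> opp_side b k v z.
Proof.
rewrite /same_side /opp_side => h1 h2.
set p := dot u b - _ in h1 h2 *; set q := dot v b - _ in h1 *; set r := dot z b - _ in h2 *.
have [h|h|e] := ltrgtP p 0; last by move: h1; rewrite e mul0r ltxx.
  by move: h1 h2; rewrite nmulr_rgt0 // nmulr_rlt0 // => q0 r0; rewrite nmulr_rlt0.
by move: h1 h2; rewrite pmulr_rgt0 // pmulr_rlt0 // => q0 r0; rewrite pmulr_rlt0.
Qed.

(** The exchange condition: either the first letter is the reflection in this hyperplane and
    cancels, or that letter carries the hyperplane to one handled by the rest of the word. *)
Lemma exchange x n b k : word_len Phi rho x n -> b \in Phi -> opp_side b k a (x a) ->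
  exists2 m, n = m.+1 & word_len Phi rho (refl b k \o x) m.
Proof.
elim: n x b k => [|n IH] x b k.
  move=> /word0_inv -> _; rewrite /opp_side -expr2 => h.
  by have := sqr_ge0 (dot a b - k%:~R); rewrite leNgt h.
move=> /word_cons_inv[s [x' [hs hx' ->]]] bP op; exists n => //.
have [c [l [es ad]]] := simple_adjacent HPhi Hrho Ha hs.
have cP : c \in Phi by case: ad.
have c0 := root_neq0 HPhi cP; have sP := simple_inW hs.
have [ss|os] := side_cases k bP ga (inW_generic HPhi sP ga); last first.
  have -> : refl b k = s by rewrite es; apply: adjacent_opp ad bP os.
  by rewrite -[_ \o _]/((s \o s) \o x') (simple_invol HPhi hs).
have [p hp] := root_int HPhi bP cP.
have e : refl b k \o s = s \o refl (refl c 0 b) (k - l * p).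
  have hp' : dot (refl c 0 b) (coroot c) = (- p)%:~R by rewrite dot_refl_coroot // hp intrN.
  rewrite es (refl_conj l _ c0 hp') reflK //.
  by congr (refl b _ \o _); ring.
have op' : opp_side (refl c 0 b) (k - l * p) a (x' a).
  have e1 u : dot (s u) b - k%:~R = dot u (refl c 0 b) - (k - l * p)%:~R.
    by rewrite es dot_refl_root hp intrB intrM; ring.
  by have := side_trans ss op; rewrite /opp_side /= !e1.
have [m -> hm] := IH _ _ _ hx' (root_refl HPhi cP bP) op'.
rewrite -[_ \o _]/((refl b k \o s) \o x') e.
exact: (word_cons hs hm).
Qed.

Lemma word_sep_le x n : word_len Phi rho x n -> (sep Phi predT a (x a) <= n.*2)%N.
Proof.
elim: n x => [|n IH] x.
  by move=> /word0_inv -> /=; rewrite /sep big1 // => g _; rewrite subrr.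
move=> /word_cons_inv[s [x' [hs hx' ->]]].
have [c [l [es [cP _ _ s2]]]] := simple_adjacent HPhi Hrho Ha hs.
have := sep_triangle Phi predT a (s a) (s (x' a)).
have := IH _ hx'; rewrite (inW_sep HPhi _ _ _ (simple_inW hs)) /=; lia.
Qed.

(** A new first letter either adds one separating hyperplane or allows an exchange that shortens the
    word. Hence minimal words attain the bound of [word_sep_le]. *)
Lemma word_sep x n : word_len Phi rho x n ->
  sep Phi predT a (x a) = n.*2 \/ exists2 m, (m < n)%N & word_len Phi rho x m.
Proof.
elim: n x => [|n IH] x.
  by move=> /word0_inv -> /=; left; rewrite /sep big1 // => g _; rewrite subrr.
move=> hx; have le := word_sep_le hx.
move: hx le => /word_cons_inv[s [x' [hs hx' ->]]] le.
have [e|[m mn hm]] := IH _ hx'; last by right; exists m.+1 => //; apply: word_cons.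
have [c [l [es ad]]] := simple_adjacent HPhi Hrho Ha hs.
have cP : c \in Phi by case: ad.
have gx' := inW_generic HPhi (word_inW hx') ga.
have [ss|os] := side_cases l cP ga gx'.
  left; have := sep_refl_ge HPhi predT cP ga gx' ss.
  by rewrite -es /= in le *; rewrite e; lia.
right; have [m en hm] := exchange hx' cP os; exists m; first by lia.
by rewrite es.
Qed.

Lemma ell_sep x : inW Phi x -> sep Phi predT a (x a) = (ell Phi rho x).*2.
Proof.
move=> hx; have [n0 hn0] := inW_word hx.
(* A least word length exists, so the choice operator in [ell] does return it. *)
have ex : exists n, word_len Phi rho x n /\ forall m, word_len Phi rho x m -> (n <= m)%N.
  have ex0 : exists n, `[< word_len Phi rho x n >] by exists n0; apply/asboolP.
  have [n /asboolP hn hmin] := ex_minnP ex0.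
  by exists n; split => // m hm; apply: hmin; apply/asboolP.
have [hn hmin] := epsilon_spec (inhabits 0%N) _ ex.
rewrite -/(ell Phi rho x) in hn hmin.
have [//|[m lt hm]] := word_sep hn.
by have := hmin _ hm; rewrite leqNgt lt.
Qed.

End Length.

(** * Monotone functions for the Bruhat order *)

Section Dominance.
Variables (R : realType) (Phi : seq 'rV[R]_2).
Hypothesis HPhi : root_system Phi.
Notation E := 'rV[R]_2.
Variable rho : E.
Hypothesis Hrho : regular Phi rho.
Variable a : E.
Hypothesis Ha : A0 Phi rho a.
Implicit Types (u v z b g c : E) (k l : int) (r s w x y : E -> E).

Let ga : generic Phi a := A0_generic HPhi Hrho Ha.

Lemma sep_split q u v :
  sep Phi predT u v = (sep Phi q u v + sep Phi (predC q) u v)%N.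
Proof. by rewrite /sep (bigID (fun g => q (dot g g))). Qed.

(** On opposite sides, the reflection would decrease the number of separating hyperplanes. *)
Lemma ell_lt_same_side x b k : inW Phi x -> b \in Phi ->
  (ell Phi rho x < ell Phi rho (refl b k \o x))%N -> same_side b k a (x a).
Proof.
move=> hx bP; rewrite -ltn_double -!(ell_sep HPhi Hrho Ha) //=; last exact: inW_refl_l.
have gx := inW_generic HPhi hx ga.
have [//|op] := side_cases k bP ga gx.
by have := sep_refl_le HPhi bP ga gx op; lia.
Qed.

Variable N : R.

(** For generic points: the same alcove of the coarser arrangement of the roots of squared length
    [N]. *)
Definition same_fl u v := forall g, g \in Phi -> dot g g = N -> fl u g = fl v g.

Lemma inW_same_fl x u v : inW Phi x -> same_fl u v -> same_fl (x u) (x v).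
Proof.
move=> hx uv; elim/inW_ind: x / hx => // c l x cP _ IH g gP gN /=.
have [n hn] := root_int HPhi gP cP.
by rewrite !(fl_refl _ _ hn) IH ?(root_refl HPhi) // refl_norm // (root_neq0 HPhi).
Qed.

Definition refl_closed (M : E -> Prop) :=
  forall g mu, g \in Phi -> dot g g = N -> M mu -> M (refl g 0 mu).

(* Reflecting away from the alcove of [a] cannot decrease [max_M <_ - a, mu>]. *)
Lemma refl_dominates M b k v z mu : refl_closed M -> b \in Phi -> dot b b = N ->
  generic Phi z -> same_fl v z -> same_side b k a z -> M mu ->
  exists2 mu', M mu' & dot (v - a) mu <= dot (refl b k v - a) mu'.
Proof.
move=> hM bP bN gz vz ss Mmu.
have hv : (dot a b < k%:~R /\ dot v b < k%:~R) \/ (k%:~R < dot a b /\ k%:~R <= dot v b).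
  move: ss; rewrite /same_side; have [h|h|->] := ltrgtP (dot a b - k%:~R) 0;
    last by rewrite mul0r ltxx.
    rewrite nmulr_rgt0 // subr_lt0 => h'; left; split; first by lra.
    by rewrite -fl_lt (vz _ bP bN) fl_lt.
  rewrite pmulr_rgt0 // subr_gt0 => h'; right; split; first by lra.
  by rewrite -fl_ge (vz _ bP bN) fl_ge ltW.
have b0 := root_neq0 HPhi bP.
set p := dot mu (coroot b); set d := dot v b - k%:~R.
have e1 : dot (refl b k v - a) mu = dot (v - a) mu - d * p.
  by rewrite dotBl dot_refl dotBl /d /p; ring.
have e2 : dot (refl b k v - a) (refl b 0 mu) = dot (v - a) mu - p * (k%:~R - dot a b).
  rewrite -dot_refl0C dot_refl e1 (dotBl _ a b) dot_refl_self // /d /p; ring.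
(* The reflection takes [d * p] away from the pairing with [mu]; if this is a real loss, the mirror
   image of [mu] compensates it. *)
have [dp|dp] := leP (d * p) 0; first by exists mu => //; lra.
exists (refl b 0 mu); first exact: hM.
rewrite e2 lerBrDl gerDr.
case: hv => -[h1 h2].
  have d0 : d < 0 by rewrite subr_lt0.
  by move: dp; rewrite nmulr_rgt0 // => p0; rewrite mulr_le0_ge0 ?(ltW p0) //; lra.
have d0 : 0 <= d by rewrite subr_ge0.
have p0 : 0 < p.
  by rewrite ltNge; apply: contraTN dp => p0; rewrite -leNgt mulr_ge0_le0.
by rewrite mulr_ge0_le0 ?(ltW p0) //; lra.
Qed.

(** The count over the other root lengths never decreases along a chain and grows at each reflection
    in such a root. Equal counts at both ends thus leave only roots of squared length [N], and
    [refl_dominates] can be composed. *)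
Lemma bruhat_dominates w x : inW Phi w -> bruhat_le Phi rho w x ->
  [/\ inW Phi x,
      (sep Phi (fun m : R => m != N) a (w a) <= sep Phi (fun m : R => m != N) a (x a))%N &
      sep Phi (fun m : R => m != N) a (x a) = sep Phi (fun m : R => m != N) a (w a) ->
      forall M v, refl_closed M -> same_fl v a -> forall mu, M mu ->
        exists2 mu', M mu' & dot (w v - a) mu <= dot (x v - a) mu'].
Proof.
move=> hw; elim/clos_refl_trans_ind_left: x / => [|x y _ [hx le H] [t [ht ey lt]]].
  by split => // _ M v _ _ mu Mmu; exists mu.
have [c [l [cP et]]] := ht.
have [b [k [bP e]]] := inW_conj HPhi l hx cP.
have {}ey : y = refl b k \o x by rewrite ey et.
rewrite ey in lt *; have ss := ell_lt_same_side hx bP lt.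
have gx := inW_generic HPhi hx ga.
have := sep_refl_ge HPhi (fun m : R => m != N) bP ga gx ss => ge.
split; [exact: inW_refl_l|by rewrite /=; lia|].
move=> /= eD M v hM va mu Mmu.
have [bN|bN] := eqVneq (dot b b) N; last by move: ge; rewrite bN; lia.
have [|mu1 Mmu1 le1] := H _ M v hM va mu Mmu; first by move: ge; rewrite bN eqxx; lia.
have [mu2 Mmu2 le2] := refl_dominates hM bP bN gx (inW_same_fl hx va) ss Mmu1.
by exists mu2 => //; apply: le_trans le1 le2.
Qed.

End Dominance.

(** * Roots of a given length *)

Section SameNorm.
Variables (R : realType) (Phi : seq 'rV[R]_2).
Hypothesis HPhi : root_system Phi.
Notation E := 'rV[R]_2.
Implicit Types (u v b g c d : E).

(** Three vectors of a plane have Gram determinant 0. *)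
Lemma gram3 u v d :
  dot d d * (dot u u * dot v v - dot u v ^+ 2) =
  dot d u ^+ 2 * dot v v + dot d v ^+ 2 * dot u u - 2 * dot d u * dot d v * dot u v.
Proof. by rewrite !dotE; ring. Qed.

Lemma reflN0 b : refl (- b) 0 = refl b 0.
Proof. by rewrite -{1}oppr0 reflN. Qed.

Lemma refl0E c v : refl c 0 v = v - dot v (coroot c) *: c.
Proof. by rewrite reflE subr0 dot_coroot /coroot scalerA; congr (_ - _ *: _); ring. Qed.

Lemma dot_sub_eq0 u v : dot (u - v) (u - v) = 0 -> u = v.
Proof.
move=> e; apply/eqP; rewrite -subr_eq0; apply: contraT => h.
by have := dot_gt0 (u - v); rewrite h e ltxx.
Qed.

(** The squared norms of [b - g] and [b + g] are [2 - n] and [2 + n] times that of [g]; they are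
    nonnegative, and vanish at the extreme values. *)
Lemma same_norm_pair b g : b \in Phi -> g \in Phi -> dot b b = dot g g ->
  exists n : int, [/\ dot b (coroot g) = n%:~R, dot b g = n%:~R * dot g g / 2,
    -2 <= n <= 2, (n = 2 -> b = g) & (n = -2 -> b = - g)].
Proof.
move=> bP gP bg; have [n hn] := root_int HPhi bP gP; exists n.
have g0 := root_gt0 HPhi gP.
have e : dot b g = n%:~R * dot g g / 2.
  by rewrite -hn dot_coroot; field; rewrite gt_eqF.
have em : dot (b - g) (b - g) = (2 - n%:~R) * dot g g.
  by rewrite !dot_lin (dotC g b) bg e; field.
have ep : dot (b - - g) (b - - g) = (2 + n%:~R) * dot g g.
  by rewrite !dot_lin (dotC g b) bg e; field.
have pos u : 0 <= dot u u by rewrite dotE addr_ge0 // -expr2 sqr_ge0.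
split => //.
- have := pos (b - g); have := pos (b - - g); rewrite em ep !pmulr_lge0 // => h1 h2.
  have h3 : (-2)%:~R <= n%:~R :> R by rewrite intrN; lra.
  have h4 : n%:~R <= 2%:~R :> R by lra.
  by move: h3 h4; rewrite !ler_int => -> ->.
- by move=> n2; apply: dot_sub_eq0; rewrite em n2 subrr mul0r.
- by move=> n2; apply: dot_sub_eq0; rewrite ep n2 intrN subrr mul0r.
Qed.

(** The Gram relation becomes [n * n + p * p = 4], whose integral solutions put [g] on the line of
    [b] or orthogonal to it. *)
Lemma orthogonal_closed b c : b \in Phi -> c \in Phi -> dot b b = dot c c ->
  dot b c = 0 -> refl_closed Phi (dot b b) (fun mu => mu = b \/ mu = - b).
Proof.
move=> bP cP bc0 orth g mu gP gN.
have [n [hn en nb n2 nN2]] := same_norm_pair bP gP (esym gN).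
have [p [hp ep pb _ _]] := same_norm_pair cP gP (etrans (esym bc0) (esym gN)).
have b0 := root_gt0 HPhi bP; have bne := root_neq0 HPhi bP.
have np : n * n + p * p = 4.
  have := gram3 b c g; rewrite orth -bc0 gN (dotC g b) (dotC g c) en ep gN => h.
  apply: (@intr_inj R); rewrite intrD !intrM.
  have B3 : dot b b ^+ 3 != 0 by rewrite expf_neq0 // gt_eqF.
  apply: (mulIf B3).
  transitivity (4 * (dot b b * (dot b b * dot b b - 0 ^+ 2))); last by ring.
  by rewrite h; field.
have n3 : [\/ n = 0, n = 2 | n = -2].
  have hn5 : n = -2 \/ n = -1 \/ n = 0 \/ n = 1 \/ n = 2 by lia.
  have hp5 : p = -2 \/ p = -1 \/ p = 0 \/ p = 1 \/ p = 2 by lia.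
  move: np; case: hn5 => [|[|[|[|]]]] ->; case: hp5 => [|[|[|[|]]]] ->; move=> // _;
    by [constructor 1|constructor 2|constructor 3].
have gb : refl g 0 b = b \/ refl g 0 b = - b.
  case: n3 => e; first by left; apply: refl_fix; rewrite en e; ring.
    by right; rewrite -(n2 e) refl0N.
  have -> : g = - b by rewrite (nN2 e) opprK.
  by right; rewrite reflN0 refl0N.
have gNb : refl g 0 (- b) = - refl g 0 b.
  by apply: rV2P; rewrite /refl !dot_lin !mxE; ring.
by case=> ->; rewrite ?gNb; case: gb => ->; rewrite ?opprK; [left|right|right|left].
Qed.

Section Hexagonal.
Variables b c : E.
Hypotheses (bP : b \in Phi) (cP : c \in Phi).
Hypotheses (bcN : dot c c = dot b b) (hbc : dot b c = dot b b / 2).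

Let b0 : dot b b != 0. Proof. by rewrite gt_eqF // (root_gt0 HPhi). Qed.

(** The Gram relation becomes [n * n + p * p - n * p = 3], with six integral solutions, one for each
    vertex of the hexagon. *)
Lemma hexagon g : g \in Phi -> dot g g = dot b b ->
  exists d, [\/ d = b, d = c | d = b - c] /\ (g = d \/ g = - d).
Proof.
move=> gP gN.
have [n [_ en nb n2 nN2]] := same_norm_pair gP bP gN.
have [p [_ ep pb p2 pN2]] := same_norm_pair gP cP (etrans gN (esym bcN)).
rewrite bcN in ep.
have np : n * n + p * p - n * p = 3.
  have := gram3 b c g; rewrite bcN gN en ep hbc => h.
  apply: (@intr_inj R); rewrite intrB intrD !intrM.
  have B3 : dot b b ^+ 3 != 0 by rewrite expf_neq0.
  apply: (mulIf B3).
  transitivity (4 * (dot b b * (dot b b * dot b b - (dot b b / 2) ^+ 2))); last by field.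
  by rewrite h; field.
have [e|e1] := eqVneq n 2; first by exists b; split; [constructor|left; apply: n2].
have [e|e2] := eqVneq n (-2); first by exists b; split; [constructor|right; apply: nN2].
have [e|e3] := eqVneq p 2; first by exists c; split; [constructor|left; apply: p2].
have [e|e4] := eqVneq p (-2); first by exists c; split; [constructor|right; apply: pN2].
exists (b - c); split; first by constructor 3.
have hn5 : n = -1 \/ n = 0 \/ n = 1 by lia.
have hp5 : p = -1 \/ p = 0 \/ p = 1 by lia.
have : (n = 1 /\ p = -1) \/ (n = -1 /\ p = 1).
  by move: np; case: hn5 => [|[|]] ->; case: hp5 => [|[|]] ->; move=> // _; [right|left].
case=> -[nE pE]; [left|right]; apply: dot_sub_eq0;
  rewrite !dot_lin (dotC b g) (dotC c g) (dotC c b) en ep hbc bcN gN nE pE; by field.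
Qed.

(** The fundamental weight orthogonal to [b - c] for the simple system [c], [b - c] of the hexagon;
    its orbit is the triangle of [hexagonal_closed]. *)
Definition weight : E := 3^-1 *: (b + c).

Lemma weight_b : dot weight (coroot b) = 1.
Proof. by rewrite dot_coroot /weight !dot_lin (dotC c b) hbc; field. Qed.
Lemma weight_c : dot weight (coroot c) = 1.
Proof. by rewrite dot_coroot /weight !dot_lin bcN hbc; field. Qed.
Lemma weight_bc : dot weight (b - c) = 0.
Proof. by rewrite /weight !dot_lin (dotC c b) hbc bcN; field. Qed.

Lemma hexagonal_closed : refl_closed Phi (dot b b)
  (fun mu => [\/ mu = weight, mu = weight - b | mu = weight - c]).
Proof.
move=> g mu gP gN.
have [d [hd hg]] := hexagon gP gN.
have -> : refl g 0 mu = refl d 0 mu.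
  by case: hg => -> //; rewrite reflN0.
have hbb : dot b (coroot b) = 2 by rewrite dot_coroot mulfK.
have hcc : dot c (coroot c) = 2 by rewrite dot_coroot bcN mulfK.
have hcb : dot c (coroot b) = 1 by rewrite dot_coroot (dotC c b) hbc; field.
have hbc' : dot b (coroot c) = 1 by rewrite dot_coroot bcN hbc; field.
have bcn : dot (b - c) (b - c) = dot b b.
  by rewrite !dot_lin (dotC c b) bcN hbc; field.
have wbc : dot weight (coroot (b - c)) = 0 by rewrite dot_coroot weight_bc mulr0 mul0r.
have b_bc : dot b (coroot (b - c)) = 1.
  by rewrite dot_coroot bcn dotBr hbc; field.
have c_bc : dot c (coroot (b - c)) = -1.
  by rewrite dot_coroot bcn dotBr bcN (dotC c b) hbc; field.
case: hd => ->; rewrite refl0E; case=> ->;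
  rewrite ?dotBl ?weight_b ?weight_c ?wbc ?hbb ?hcc ?hcb ?hbc' ?b_bc ?c_bc.
- by constructor 2; rewrite scale1r.
- by constructor 1; apply: rV2P; rewrite !mxE; ring.
- by constructor 3; rewrite subrr scale0r subr0.
- by constructor 3; rewrite scale1r.
- by constructor 2; rewrite subrr scale0r subr0.
- by constructor 1; apply: rV2P; rewrite !mxE; ring.
- by constructor 1; rewrite scale0r subr0.
- by constructor 3; apply: rV2P; rewrite !mxE; ring.
- by constructor 2; apply: rV2P; rewrite !mxE; ring.
Qed.

Hypothesis bcP : b - c \in Phi.

(* [v] is taken close to the vertex where [b] and [c] both equal their floor. *)
Lemma near_vertex z (e : R) : generic Phi z -> 0 < e ->
  exists2 v, same_fl Phi (dot b b) v z & dot v b < (fl z b)%:~R + e.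
Proof.
move=> gz e0.
set f := dot z b - (fl z b)%:~R; set f' := dot z c - (fl z c)%:~R.
have f0 : 0 < f by rewrite subr_gt0; apply: gz.
have f'0 : 0 < f' by rewrite subr_gt0; apply: gz.
have f1 : f < 1 by have := floorD1_gt (dot z b); rewrite intrD -/(fl z b) /f; lra.
have f'1 : f' < 1 by have := floorD1_gt (dot z c); rewrite intrD -/(fl z c) /f'; lra.
have [t [[t0 h1] h2]] := small_ex (small_and
  (small_and (ex_intro2 _ _ 1 ltr01 (fun t h => proj1 (andP h))) (small_gt0 (-1) ltr01))
  (small_gt0 (- f) e0)).
(* The offset of [z] from the vertex, found by inverting the pairings with the two coroots; [v] is
   the contraction of [z] towards the vertex by the factor [t]. *)
pose u : E := ((2 * f - f') / 3) *: coroot b + ((2 * f' - f) / 3) *: coroot c.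
have ub : dot u b = f.
  rewrite /u dotDl (dotZl _ (coroot b)) (dotZl _ (coroot c)) !(dotC (coroot _)).
  by rewrite !dot_coroot bcN hbc; field.
have uc : dot u c = f'.
  rewrite /u dotDl (dotZl _ (coroot b)) (dotZl _ (coroot c)) !(dotC (coroot _)).
  by rewrite !dot_coroot (dotC c b) bcN hbc; field.
pose v : E := z - (1 - t) *: u.
have vb : dot v b = (fl z b)%:~R + t * f by rewrite dotBl dotZl ub /f; ring.
have vc : dot v c = (fl z c)%:~R + t * f' by rewrite dotBl dotZl uc /f'; ring.
have {}h1 : t < 1 by lra.
have pos (s : R) : 0 < s -> s < 1 -> 0 < t * s < 1.
  by move=> s0 s1; rewrite mulr_gt0 //=; apply: lt_trans s1; rewrite -[ltRHS]mul1r ltr_pM2r.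
have tf := pos _ f0 f1; have tf' := pos _ f'0 f'1.
have flb : fl v b = fl z b by apply: floor_def; rewrite intrD vb; lra.
have flc : fl v c = fl z c by apply: floor_def; rewrite intrD vc; lra.
have zbc : dot z (b - c) = (fl z b - fl z c)%:~R + (f - f').
  by rewrite dotBr intrB /f /f'; ring.
have vbc : dot v (b - c) = (fl z b - fl z c)%:~R + (t * f - t * f').
  by rewrite dotBr vb vc intrB; ring.
(* The floor along [b - c] depends only on the sign of [f - f'], which the contraction preserves;
   equality would put [z] on a hyperplane. *)
have [flbc gbc] : fl v (b - c) = fl z (b - c) /\ (fl v (b - c))%:~R < dot v (b - c).
  have [ff|ff|ff] := ltrgtP f f'.
  - have h : fl z (b - c) = fl z b - fl z c - 1.
      by apply: floor_def; rewrite subrK zbc (intrB _ (_ - _)); lra.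
    have ht := pos (f' - f) ltac:(lra) ltac:(lra); rewrite mulrBr in ht.
    have h' : fl v (b - c) = fl z b - fl z c - 1.
      by apply: floor_def; rewrite subrK vbc (intrB _ (_ - _)); lra.
    by rewrite h' h; split => //; rewrite vbc (intrB _ (_ - _)); lra.
  - have h : fl z (b - c) = fl z b - fl z c.
      by apply: floor_def; rewrite zbc intrD; lra.
    have ht := pos (f - f') ltac:(lra) ltac:(lra); rewrite mulrBr in ht.
    have h' : fl v (b - c) = fl z b - fl z c.
      by apply: floor_def; rewrite vbc intrD; lra.
    by rewrite h' h; split => //; rewrite vbc; lra.
  - by have := gz _ bcP; rewrite /fl zbc ff subrr addr0 intrKfloor ltxx.
exists v; last by rewrite vb; lra.
have neg d : d \in Phi -> fl v d = fl z d -> (fl v d)%:~R < dot v d -> fl v (- d) = fl z (- d).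
  move=> dP e1 lt1; rewrite (flN gz dP) -e1; apply: floor_def; rewrite subrK dotNr.
  have := floorD1_gt (dot v d); rewrite -/(fl v d) intrD intrB intrN; lra.
move=> g gP /(hexagon gP)[d [[->|->|->] [->|->]]] //; apply: neg => //.
  by rewrite flb vb; lra.
by rewrite flc vc; lra.
Qed.
End Hexagonal.
End SameNorm.

(** * The chain of parallel reflections *)

Section Chain.
Variables (R : realType) (Phi : seq 'rV[R]_2).
Hypothesis HPhi : root_system Phi.
Notation E := 'rV[R]_2.
Variable rho : E.
Hypothesis Hrho : regular Phi rho.
Variable a : E.
Hypothesis Ha : A0 Phi rho a.
Implicit Types (u v z b g d : E) (k l m : int).

Let ga : generic Phi a := A0_generic HPhi Hrho Ha.

Variables (w s : E -> E) (alpha : E) (c : int) (n : nat).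
Hypotheses (Hw : inW Phi w) (Hs : simple_refl Phi rho s).
Hypothesis Hdesc : (ell Phi rho (w \o s) < ell Phi rho w)%N.
Hypotheses (Halpha : alpha \in Phi) (Hn : (1 <= n)%N).
Hypothesis Hstrip : forall v, A0 Phi rho v -> c%:~R < dot (w v) alpha < (c + 1)%:~R.
Hypothesis Hchain : forall t : nat, (1 <= t <= n)%N ->
     ell Phi rho (rprod alpha c t \o w \o s)
       = (ell Phi rho (rprod alpha c t.-1 \o w \o s)).+1
     /\ rprod alpha c t \o w \o s <> rprod alpha c t.-1 \o w.

Let x t := rprod alpha c t \o w \o s.
Let y t := rprod alpha c t \o w.
Let D (q : pred R) (f : E -> E) : nat := sep Phi q a (f a).

Lemma rprod_inW t : inW Phi (rprod alpha c t).
Proof. by elim: t => [|t IH]; [exact: inW_id|exact: inW_refl_l]. Qed.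

Lemma y_inW t : inW Phi (y t).
Proof. exact: inW_comp (rprod_inW t) Hw. Qed.
Lemma x_inW t : inW Phi (x t).
Proof. exact: inW_comp (y_inW t) (simple_inW Hs). Qed.

Lemma D_ell f : inW Phi f -> D predT f = (ell Phi rho f).*2.
Proof. by move=> hf; exact: (ell_sep HPhi Hrho Ha hf). Qed.

Let gx t : generic Phi (x t a). Proof. exact: inW_generic (x_inW t) ga. Qed.
Let gy t : generic Phi (y t a). Proof. exact: inW_generic (y_inW t) ga. Qed.

Lemma x_ell t : (t < n)%N -> ell Phi rho (x t.+1) = (ell Phi rho (x t)).+1.
Proof. by move=> tn; have [] := Hchain (t := t.+1) tn. Qed.

Lemma x_step t : (t < n)%N -> D predT (x t.+1) = (D predT (x t) + 2)%N.
Proof.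
by move=> tn; rewrite !D_ell ?x_ell ?doubleS ?addn2 //; exact: x_inW.
Qed.

Lemma x_same_side t : (t < n)%N -> same_side alpha (c + t.+1%:Z) a (x t a).
Proof.
move=> tn; apply: (ell_lt_same_side HPhi Hrho Ha (x_inW t) Halpha).
by rewrite -[_ \o x t]/(x t.+1) x_ell.
Qed.

(** The root is oriented so that [a] and the alcove of [x t] both lie below the wall; this encodes
    that [x t] is shorter than [y t]. *)
Definition wall t b j := [/\ adjacent Phi b j (x t a) (y t a), y t = refl b j \o x t,
   dot (x t a) b < j%:~R & dot a b < j%:~R].

Lemma wall0 : exists b j, wall 0 b j.
Proof.
have [b [j [e ad]]] := adjacent_right HPhi Hrho Ha (x_inW 0) Hs.
have ey : x 0 \o s = y 0 by rewrite -[LHS]/(w \o (s \o s)) (simple_invol HPhi Hs).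
have ey' : x 0 (s a) = y 0 a by rewrite -ey.
rewrite ey' ey in ad e.
have bP : b \in Phi by case: ad.
have ss : same_side b j a (x 0 a).
  apply: (ell_lt_same_side HPhi Hrho Ha (x_inW 0) bP).
  by rewrite -e; exact: Hdesc.
move: ss; rewrite /same_side; have [h|h|->] := ltrgtP (dot a b - j%:~R) 0;
    last by rewrite mul0r ltxx.
  by rewrite nmulr_rgt0 // => h'; exists b, j; split => //; lra.
rewrite pmulr_rgt0 // => h'; exists (- b), (- j); split.
- exact: adjacentN.
- by rewrite reflN.
- by rewrite dotNr intrN; lra.
- by rewrite dotNr intrN; lra.
Qed.

(* The lifting property: if the wall crossed from [x t] to [y t] stopped
   bounding the alcove of [x t] from above at time [t], then [x t] would be the
   excluded element [y t.-1]. *)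
Lemma wall_step t b j : (t < n)%N -> wall t b j -> exists j', wall t.+1 (refl alpha 0 b) j'.
Proof.
move=> tn [ad ey xb ab]; have bP : b \in Phi by case: ad.
set k := c + t.+1%:Z; have a0 := root_neq0 HPhi Halpha.
have [p hp ad'] := adjacent_refl HPhi k Halpha ad.
exists (j - k * p).
have ex : refl alpha k (x t a) = x t.+1 a by [].
have eyy : refl alpha k (y t a) = y t.+1 a by [].
rewrite ex eyy in ad'.
have dx : dot (x t.+1 a) (refl alpha 0 b) - (j - k * p)%:~R = dot (x t a) b - j%:~R.
  rewrite -ex dot_refl_root reflK // dot_refl_coroot // hp intrB intrM; ring.
have ey' : y t.+1 = refl (refl alpha 0 b) (j - k * p) \o x t.+1.
  rewrite -[LHS]/(refl alpha k \o y t) ey -[LHS]/((refl alpha k \o refl b j) \o x t).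
  by rewrite (refl_conj k j a0 hp).
have xb' : dot (x t.+1 a) (refl alpha 0 b) < (j - k * p)%:~R by lra.
split => //.
have sP := root_refl HPhi Halpha bP.
have [ss|op] := side_cases (j - k * p) sP ga (gx t.+1).
  move: ss; rewrite /same_side nmulr_lgt0 ?subr_lt0 //.
(* If the turned wall separates [a] from [x t.+1], the count of [y t.+1] is at least 2 below that of
   [x t.+1], hence below that of [y t]. So the mirror of the next reflection separates [a] from
   [y t] but not from [x t], and must be the wall. *)
have Dy : D predT (y t) = (D predT (x t) + 2)%N.
  apply: (adjacent_sep1 HPhi ad ga).
  by rewrite /same_side nmulr_lgt0 ?subr_lt0.
have Dy' : (D predT (y t.+1) + 2 <= D predT (x t.+1))%N.
  by rewrite /D ey'; apply: sep_refl_le.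
have ssx := x_same_side tn.
have [ssy|opy] := side_cases k Halpha ga (gy t).
  have := sep_refl_ge HPhi predT Halpha ga (gy t) ssy.
  rewrite eyy -/(D predT (y t)) -/(D predT (y t.+1)).
  by move: Dy'; rewrite x_step //= Dy; lia.
have e := adjacent_opp HPhi ad Halpha (side_trans ssx opy).
have [_ []] := Hchain (t := t.+1) tn.
by rewrite -[LHS]/(refl alpha k \o x t) e -ey.
Qed.

Let N := dot alpha alpha.
Let q := fun m : R => m != N.

(** Each step raises the total count by exactly 2, and the roots as long as [alpha] already account
    for all of it. *)
Lemma x_other t : (t <= n)%N -> D q (x t) = D q (x 0).
Proof.
elim: t => // t IH tn; rewrite -IH ?(ltnW tn) //.
have ss := x_same_side tn.
have h1 := sep_refl_ge HPhi q Halpha ga (gx t) ss.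
have h2 := sep_refl_ge HPhi (predC q) Halpha ga (gx t) ss.
have := x_step tn; rewrite /D !(sep_split _ q) -[x t.+1 a]/(refl alpha (c + t.+1%:Z) (x t a)).
have qF : q (dot alpha alpha) = false by rewrite /q eqxx.
rewrite qF in h1; rewrite [predC _ _]/= qF /= in h2.
set A := sep Phi q a (refl _ _ _) in h1 *; set A' := sep Phi (predC q) a (refl _ _ _) in h2 *.
set B := sep Phi q a (x t a) in h1 *; set B' := sep Phi (predC q) a (x t a) in h2 *.
clearbody A A' B B'; lia.
Qed.

Hypothesis Hle : bruhat_le Phi rho w (x n).

(** The count of [w] is squeezed between the equal counts of [x 0] and [x n]; a wall of another root
    length would add 2 from [x 0] to [w]. *)
Lemma x0_other b j : wall 0 b j -> D q (x 0) = D q w /\ dot b b = N.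
Proof.
move=> [ad ey xb ab]; have bP : b \in Phi by case: ad.
have [_ le _] := bruhat_dominates HPhi Hrho Ha N Hw Hle.
have ss : same_side b j a (x 0 a) by rewrite /same_side nmulr_lgt0 ?subr_lt0.
have e0 : refl b j (x 0 a) = w a by rewrite -[RHS]/(y 0 a) ey.
have le2 := sep_refl_ge HPhi q bP ga (gx 0) ss; rewrite e0 -/(D q w) -/(D q (x 0)) in le2.
have le1 : (D q w <= D q (x 0))%N by rewrite -(x_other (t := n)).
have [bN|bN] := eqVneq (dot b b) N.
  split => //; apply/eqP; rewrite eqn_leq le1 andbT.
  by apply: leq_trans (leq_addr _ _) le2.
have qT : q (dot b b) = true by rewrite /q bN.
by move: (leq_trans le2 le1); rewrite qT -[leqRHS]addn0 leq_add2l.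
Qed.

Lemma alpha_pos : 0 < N. Proof. exact: (root_gt0 HPhi Halpha). Qed.

Lemma y_strip t : (c + t%:Z)%:~R < dot (y t a) alpha < (c + t%:Z + 1)%:~R.
Proof.
elim: t => [|t IH]; first by rewrite addr0; exact: Hstrip.
rewrite -[y t.+1 a]/(refl alpha (c + t.+1%:Z) (y t a)) dot_refl_self ?(root_neq0 HPhi) //.
move: IH; rewrite -addn1 PoszD !intrD; lra.
Qed.

Lemma fl_y t : fl (y t a) alpha = c + t%:Z.
Proof. by apply: floor_def; have := y_strip t; lra. Qed.

Lemma wall_fl t b j : wall t b j -> [/\ fl (x t a) b = j - 1, fl (y t a) b = j,
  fl a b <= fl (x t a) b &
  forall g, g \in Phi -> g != b -> g != - b -> fl (x t a) g = fl (y t a) g].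
Proof.
move=> [ad ey xb ab]; have [e1 e2 e3] := adjacent_fl HPhi ad xb; split => //.
by rewrite e1; move: ab; rewrite -fl_lt; lia.
Qed.

Lemma wall0_neq b j : wall 0 b j -> b != alpha /\ b != - alpha.
Proof.
move=> h; have [fx fy fa _] := wall_fl h; have [ad ey xb ab] := h.
(* If [b = - alpha], the strip of [w] forces the wall to be the mirror of the first reflection, so
   [x 1 = y 0], which is excluded. If [b = alpha], the wall has root [- alpha] at time 1, and the
   two positions of [a] are incompatible. *)
split; apply/eqP => eb; last first.
  have [_ []] := Hchain (t := 1) Hn.
  suff e : refl alpha (c + 1) = refl b j.
    by rewrite -[LHS]/(refl alpha (c + 1) \o x 0) -[RHS]/(y 0) e ey.
  rewrite eb -[LHS]reflN; congr refl.
  have := fl_y 0; have := gy 0; rewrite -fy eb => gy0; rewrite (flN gy0) // => ->; lia.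
have [j' h'] := wall_step Hn h; have [fx' fy' fa' _] := wall_fl h'.
move: fa' fx' fy' fy fa fx; rewrite eb refl0N ?(root_neq0 HPhi) //.
rewrite (flN ga) // (flN (gx 1)) // (flN (gy 1)) // !fl_y; lia.
Qed.

Lemma x_strip t b j : wall t b j -> b != alpha -> b != - alpha ->
  (c + t%:Z)%:~R < dot (x t a) alpha < (c + t%:Z + 1)%:~R.
Proof.
move=> h b1 b2; have [_ _ _ e] := wall_fl h.
have {}e : fl (x t a) alpha = c + t%:Z.
  by rewrite e ?fl_y // eq_sym // eqr_oppLR.
by have := gx t Halpha; have := floorD1_gt (dot (x t a) alpha);
  rewrite -/(fl (x t a) alpha) e => -> ->.
Qed.

(* The alcove of [a] lies below the wall at time [t]; this remains visible at
   time [t.+1] although the wall has turned by then. *)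
Lemma wall_next t b j p : (t < n)%N -> wall t b j -> dot b b = N ->
  b != alpha -> b != - alpha -> dot b (coroot alpha) = p%:~R -> p = 1 \/ p = -1 ->
  fl a b <= fl (x t.+1 a) b.
Proof.
move=> tn h bN b1 b2 hp p1; have [fx fy fa fe] := wall_fl h.
have bP : b \in Phi by case: h => -[].
have st := x_strip h b1 b2.
have ex : dot (x t.+1 a) b = dot (x t a) b - (dot (x t a) alpha - (c + t%:Z + 1)%:~R) * p%:~R.
  by rewrite -[x t.+1 a]/(refl alpha (c + t.+1%:Z) (x t a)) dot_refl hp -addn1 PoszD addrA.
(* For [p = 1] the reflection raises the pairing with [b]. For [p = -1] it turns [b] into
   [b + alpha], along which [x t] and [y t] have the same floor; the position of [y t] above the
   wall and in its strip bounds this floor from below. *)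
apply: le_trans fa _; case: p1 => pE; rewrite pE in hp ex.
  by apply: le_floor; rewrite ex; lra.
have dP : b + alpha \in Phi.
  have := root_refl HPhi Halpha bP; rewrite refl0E hp intrN scaleN1r opprK //.
have apos := alpha_pos.
have d1 : b + alpha != b.
  by rewrite -subr_eq0 addrAC subrr add0r (root_neq0 HPhi).
have d2 : b + alpha != - b.
  apply: contraTneq apos => e; have ea : alpha = (-2) *: b.
    by apply: rV2P; rewrite !mxE; have := congr1 (fun z => z 0 0) e;
       have := congr1 (fun z => z 0 1) e; rewrite !mxE; lra.
  rewrite -leNgt /N ea dotZl dotZr bN; have : N = 4 * N by rewrite {1}/N ea dotZl dotZr bN; ring.
  lra.
have := fe _ dP d1 d2 => ed.
have : j + (c + t%:Z) <= fl (y t a) (b + alpha).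
  rewrite fl_ge dotDr intrD lerD //; first by rewrite -fy floor_le.
  by have := y_strip t; lra.
rewrite -ed (fl_ge _ (b + alpha)) dotDr => h3; rewrite fx fl_ge ex.
by move: h3; rewrite !intrD !intrN; lra.
Qed.

Lemma walls b j t : wall 0 b j -> (t <= n)%N ->
  exists j', wall t (if odd t then refl alpha 0 b else b) j'.
Proof.
move=> h; elim: t => [|t IH] tn; first by exists j.
have [j' h'] := IH (ltnW tn); have [j'' h''] := wall_step tn h'; exists j''.
by move: h''; rewrite /=; case: odd; rewrite //= reflK // (root_neq0 HPhi).
Qed.

Lemma dot_rprod t u mu : dot mu (coroot alpha) = 0 ->
  dot (rprod alpha c t u) mu = dot u mu.
Proof. by move=> h; elim: t => //= t IH; rewrite dot_refl h mulr0 subr0. Qed.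

Lemma dominates M v mu : refl_closed Phi N M -> same_fl Phi N v a -> M mu ->
  exists2 mu', M mu' & dot (w v - a) mu <= dot (x n v - a) mu'.
Proof.
move=> hM va Mmu; have [b [j h]] := wall0; have [e _] := x0_other h.
have [_ _ dom] := bruhat_dominates HPhi Hrho Ha N Hw Hle.
by apply: dom hM va _ Mmu; rewrite -/(D q (x n)) x_other // e.
Qed.

Lemma chain_not_orthogonal b j : wall 0 b j -> dot b (coroot alpha) <> 0.
Proof.
move=> h p0; have [_ bN] := x0_other h; have [ad ey xb ab] := h.
have bP : b \in Phi by case: ad.
have orth : dot b alpha = 0.
  have := p0; rewrite dot_coroot => /eqP; rewrite !mulf_eq0 invr_eq0 pnatr_eq0 /=.
  by rewrite (gt_eqF alpha_pos) orbF => /eqP.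
have clo := orthogonal_closed HPhi bP Halpha bN orth; rewrite bN in clo.
have [//|mu' hmu le] := dominates clo (v := a) _ (or_introl erefl).
have e1 : dot (w a) b = j%:~R *+ 2 - dot (x 0 a) b.
  by rewrite -[w a]/(y 0 a) ey /= dot_refl_self // (root_neq0 HPhi).
have e2 : dot (x n a) b = dot (x 0 a) b by rewrite /x /= dot_rprod.
(* The choice [b] would put [x 0 a] on or above the wall, and the choice [- b] would put [a]
   there. *)
by case: hmu le => ->; rewrite ?dotNr !dotBl e1 e2; lra.
Qed.

Lemma chain_absurd : False.
Proof.
have [b [j h]] := wall0; have [_ bN] := x0_other h.
have [b1 b2] := wall0_neq h; have [ad ey xb ab] := h.
have bP : b \in Phi by case: ad.
have a0 := root_neq0 HPhi Halpha.
have [p [hp ep pb p2 pN2]] := same_norm_pair HPhi bP Halpha bN.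
have p1 : p = 1 \/ p = -1.
  have n2 : p != 2 by apply: contraNneq b1 => /p2 ->.
  have nN2 : p != -2 by apply: contraNneq b2 => /pN2 ->.
  have n0 : p != 0 by apply/eqP => e; apply: (chain_not_orthogonal h); rewrite hp e.
  by lia.
pose b' := refl alpha 0 b.
have b'P : b' \in Phi by apply: root_refl.
have b'E : b' = b - p%:~R *: alpha by rewrite /b' refl0E hp.
have b'N : dot b' b' = dot b b by rewrite refl_norm.
have b'1 : b' != alpha.
  by apply: contraNneq b2 => e; rewrite -(reflK 0 a0 b) -/b' e refl0N.
have b'2 : b' != - alpha.
  apply: contraNneq b1 => e; rewrite -(reflK 0 a0 b) -/b' e.
  by rewrite -{1}(reflN0 alpha) refl0N ?oppr_eq0 // opprK.
have hp' : dot b' (coroot alpha) = (- p)%:~R by rewrite dot_refl_coroot // hp intrN.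
have pp : (p%:~R * p%:~R = 1 :> R) by case: p1 => ->; rewrite ?intrN ?mulrNN mulr1.
have hbb' : dot b b' = dot b b / 2.
  rewrite b'E dotBr dotZr ep bN -/N.
  transitivity (N - p%:~R * p%:~R * N / 2); first by field.
  by rewrite pp; field.
have bb' : b - b' = p%:~R *: alpha by rewrite b'E opprB addrC subrK.
have bb'P : b - b' \in Phi.
  by rewrite bb'; case: p1 => ->; rewrite ?intrN ?scale1r // scaleN1r opp_root.
(* One of [b], [b'] is the root of the wall at time [n]; the other was so at time [n.-1], and
   [wall_next] carries its bound one step further. *)
have good d : d = b \/ d = b' -> fl a d <= fl (x n a) d.
  move=> hd.
  have good_n e : (exists j', wall n e j') -> fl a e <= fl (x n a) e.
    by move=> [j' /wall_fl[]].
  have good_p e pe : (exists j', wall n.-1 e j') -> dot e e = N -> e != alpha -> e != - alpha ->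
      dot e (coroot alpha) = pe%:~R -> pe = 1 \/ pe = -1 -> fl a e <= fl (x n a) e.
    move=> [j' h'] eN e1 e2 he pe1; rewrite -(prednK Hn).
    by apply: (wall_next _ h' eN e1 e2 he pe1); rewrite prednK.
  have pN1 : - p = 1 \/ - p = -1 by lia.
  have wn := walls h (leqnn n); have wp := walls h (leq_pred n).
  have on : odd n = ~~ odd n.-1 by rewrite -{1}(prednK Hn).
  rewrite on -/b' in wn; rewrite -/b' in wp.
  case: hd => ->; case: (odd n.-1) wn wp => /= wn wp.
  - exact: good_n.
  - exact: good_p wp bN b1 b2 hp p1.
  - exact: good_p wp (etrans b'N bN) b'1 b'2 hp' pN1.
  - exact: good_n.
have fr d : 0 < 1 - (dot a d - (fl a d)%:~R).
  by have := floorD1_gt (dot a d); rewrite intrD -/(fl a d); lra.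
(* The room left above [a] in its strips along [b] and [b'] measures how close to the vertex [v] has
   to be. *)
have e0 : 0 < Num.min (1 - (dot a b - (fl a b)%:~R)) (1 - (dot a b' - (fl a b')%:~R)).
  by rewrite lt_min !fr.
have [v hv] := near_vertex HPhi bP b'P b'N hbb' bb'P (gx 0) e0.
rewrite -ltrBlDl lt_min => /andP[vb vb'].
have [xi hxi [xxi xix]] := inW_inv HPhi (x_inW 0).
rewrite bN -/N in hv.
have x0u : x 0 (xi v) = v by exact: (congr1 (fun f => f v) xxi).
have ua : same_fl Phi N (xi v) a.
  have := inW_same_fl HPhi hxi hv.
  by have -> : xi (x 0 a) = a by exact: (congr1 (fun f => f a) xix).
have clo := hexagonal_closed HPhi bP b'P b'N hbb'; rewrite bN -/N in clo.
have [mu' hmu le] := dominates clo ua (Or31 _ _ erefl).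
have wa : dot (weight b b') (coroot alpha) = 0.
  have := weight_bc b'N hbb'; rewrite bb' dotZr dot_coroot => /eqP.
  rewrite mulf_eq0 => /orP[/eqP e|/eqP ->]; last by rewrite mulr0 mul0r.
  by move: pp; rewrite e mul0r => /esym/eqP; rewrite oner_eq0.
have xn : dot (x n (xi v)) (weight b b') = dot v (weight b b').
  by rewrite -[x n (xi v)]/(rprod alpha c n (x 0 (xi v))) dot_rprod // x0u.
have wu : dot (w (xi v)) (weight b b') = dot v (weight b b') - (dot v b - j%:~R).
  rewrite -[w (xi v)]/(y 0 (xi v)) ey /= x0u dot_refl (weight_b HPhi bP hbb').
  by rewrite mulr1.
have low d : d = b \/ d = b' -> dot d d = N -> d \in Phi -> (fl a d)%:~R <= dot (x n (xi v)) d.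
  move=> hd dN dP; rewrite -fl_ge.
  by rewrite (inW_same_fl HPhi (x_inW n) ua dP dN); apply: good.
have [fx _ _ _] := wall_fl h; rewrite fx intrB in vb vb'.
have lb := low b (or_introl erefl) bN bP.
have lb' := low b' (or_intror erefl) (etrans b'N bN) b'P.
have vbj : dot v b < j%:~R by rewrite -fl_lt (hv _ bP bN) fl_lt.
clearbody b'; move: vb vb'; rewrite mulr1z => vb vb'.
(* The weight itself fails because [v] is below the wall. The other two vectors fail because the
   pairing of [x n (xi v)] with [b] or [b'] is at least the floor of [a], so their gain is at most a
   fractional part, less than the distance of [v] from the wall. *)
by case: hmu le => ->; rewrite ?dotBr !dotBl wu xn; lra.
Qed.

End Chain.

Theorem theorem1p4 (R : realType) (Phi : seq 'rV[R]_2) (rho : 'rV[R]_2)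
  (HPhi : root_system Phi) (Hirr : irreducible_rs Phi) (Hrho : regular Phi rho)
  (w s : 'rV[R]_2 -> 'rV[R]_2) (Hw : inW Phi w) (Hs : simple_refl Phi rho s)
  (Hdesc : (ell Phi rho (w \o s) < ell Phi rho w)%N)
  (alpha : 'rV[R]_2) (Halpha : alpha \in Phi) (c : int) (n : nat) (Hn : (1 <= n)%N)
  (Hstrip : forall v, A0 Phi rho v ->
     c%:~R < dot (w v) alpha < (c + 1)%:~R)
  (Hchain : forall t : nat, (1 <= t <= n)%N ->
     ell Phi rho (rprod alpha c t \o w \o s)
       = (ell Phi rho (rprod alpha c t.-1 \o w \o s)).+1
     /\ rprod alpha c t \o w \o s <> rprod alpha c t.-1 \o w) :
  ~ bruhat_le Phi rho w (rprod alpha c n \o w \o s).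
Proof.
move=> Hle; have [a Ha] := A0_nonempty Phi rho.
exact: (chain_absurd HPhi Hrho Ha Hw Hs Hdesc Halpha Hn Hstrip Hchain Hle).
Qed.
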